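(* Let $(M^4,g)$ be a complete noncompact Riemannian $4$-manifold satisfying the Tian--Viaclovsky hypotheses (TV) listed in the context, and let $\Omega$ be an ALE end of $M$ with group $\Gamma\subset\mathrm{SO}(4)$ and $\Gamma$-cover $\widetilde\Omega$. Let $x$ and $y$ be two coordinate systems on $\widetilde\Omega$ (each identifying a neighbourhood of infinity with the exterior of a ball in $\mathbb R^4$) such that, for some $\sigma\in(0,1)$ and some algebraic Weyl tensors $W_\infty^{(x)},W_\infty^{(y)}$, $$g^{(x)}_{ij}(x)=\delta_{ij}+\Bigl(\Xi\bigl(9|\Gamma|m_{\mathrm{ADM}}(g)\bigr)_{ijk\ell}+(W_\infty^{(x)})_{ik\ell j}\Bigr)\frac{x_kx_\ell}{|x|^4}+\mathcal O_\infty(|x|^{-2-\sigma}),$$ $$g^{(y)}_{ab}(y)=\delta_{ab}+\Bigl(\Xi\bigl(9|\Gamma|m_{\mathrm{ADM}}(g)\bigr)_{abpq}+(W_\infty^{(y)})_{apqb}\Bigr)\frac{y_py_q}{|y|^4}+\mathcal O_\infty(|y|^{-2-\sigma}),$$ and such that in each of the two coordinate systems the relative gauge condition $$g^{ij}\bigl(\Gamma(g)^k_{ij}-\Gamma(g^{\mathrm{Sch},\sharp})^k_{ij}\bigr)=0\quad\text{for every }k$$ holds, where $g^{\mathrm{Sch},\sharp}$ is the Schwarzschild reference metric written in the coordinates in question. Then there exists $A\in\mathrm O(4)$ such that $$(W_\infty^{(x)})_{ijk\ell}=A_{ai}A_{bj}A_{ck}A_{d\ell}\,(W_\infty^{(y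)})_{abcd}.$$
   Context: Repeated indices are summed; $B_R=B(0,R)\subset\mathbb R^4$; $r=|x|$; $g_E$ is the Euclidean metric. $f=\mathcal O_\infty(|x|^{-k})$ means $\partial^\alpha f=O(|x|^{-k-|\alpha|})$ for every multi-index $\alpha$. $g^{(x)}$, $g^{(y)}$ are the coordinate expressions of $g$, and $\Gamma(\cdot)^k_{ij}$ denotes Christoffel symbols. Hypotheses (TV) on a complete noncompact Riemannian $4$-manifold $(M,g)$: (1) the scalar curvature vanishes; (2) $\int_M|\mathrm{Rm}_g|^2\,dV_g<\infty$; (3) the Sobolev constant $C_S(M,g)$ is finite (i.e. $\|f\|_{L^4}\le C_S\|\nabla f\|_{L^2}$ for compactly supported Lipschitz $f$); (4) $b_1(M)<\infty$; (5) either $g$ is self-dual or anti-self-dual, or $g$ has harmonic curvature ($\operatorname{div}\mathrm{Rm}=0$). ALE end of order $\tau>0$: an end $\Omega\subset M$ with a $C^\infty$ diffeomorphism $\Phi:\Omega\to(\mathbb R^4\setminus B_R)/\Gamma$, $\Gamma\subset\mathrm{SO}(4)$ finite acting freely on $\mathbb R^4\setminus B_R$, such that the metric lifted to $\mathbb R^4\setminus B_R$ satisfies $\tilde g_{ij}-\delta_{ij}=\mathcal O_\infty(|x|^{-\tau})$. By a theorem of Tian--Viaclovsky, under (TV) each end is ALE of order $\tau$ for every $\tau<2$. $\widetilde\Omega$ is the covering of $\Omega$ corresponding to $\mathbb R^4\setminus B_R\to(\mathbb R^4\setminus B_R)/\Gamma$. ADM mass of the end (computed on the cover in ALE coordinates;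 $\nu$ the Euclidean unit normal of $S_r$; $\omega_3=2\pi^2$): $m_{\mathrm{ADM}}(g)=\frac1{6\omega_3|\Gamma|}\lim_{r\to\infty}\int_{S_r}(\partial_jg_{ij}-\partial_ig_{jj})\nu_i\,d\mu$. For $\lambda\in\mathbb R$: $\Xi(\lambda)_{ijk\ell}=-\frac\lambda9\delta_{ij}\delta_{k\ell}+\frac{2\lambda}9(\delta_{ik}\delta_{j\ell}+\delta_{i\ell}\delta_{jk})$. An algebraic Weyl tensor is a $(0,4)$-tensor on $\mathbb R^4$ with the symmetries of a curvature tensor (including the first Bianchi identity) and all traces zero. Schwarzschild reference metric: put $m_{\mathrm{Sch}}=|\Gamma|m_{\mathrm{ADM}}(g)$, $U(x)=1+\frac{m_{\mathrm{Sch}}}{2r^2}$, $g^{\mathrm{Sch}}=U^2g_E$, $\Phi^{\mathrm{Sch}}(x)=x-m_{\mathrm{Sch}}\frac{x}{r^2}$, $g^{\mathrm{Sch},\sharp}=(\Phi^{\mathrm{Sch}})^*g^{\mathrm{Sch}}$, defined near infinity. *)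

(* Defs.v *)
From HB Require Import structures.
From mathcomp Require Import all_boot all_order all_algebra finmap.
From mathcomp Require Import all_classical all_reals all_analysis.

Set Implicit Arguments.
Unset Strict Implicit.
Unset Printing Implicit Defensive.

Import Order.TTheory GRing.Theory Num.Theory.
Import numFieldNormedType.Exports.

Local Open Scope classical_set_scope.
Local Open Scope ring_scope.

Section Euclidean.
Variable R : realType.
Local Notation E4 := 'rV[R]_4.
Implicit Types (f : E4 -> R) (F : E4 -> E4) (U : set E4) (x : E4).

(* The norm `|x| on row vectors is the sup norm; it defines the usual topology,
   but the radius |x| has to be the Euclidean one. *)
Definition enorm x : R := Num.sqrt (\sum_(i < 4) x 0 i ^+ 2).

Definition exterior (r : R) : set E4 := [set x | r < enorm x].

Definition pd (i : 'I_4) f x : R := 'D_(delta_mx 0 i) f x.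

(* Multi-indices are sequences of indices; |alpha| is the size. *)
Definition pds (s : seq 'I_4) f : E4 -> R := foldr pd f s.

(* Only used for open U, on which it is the usual notion of C^oo. *)
Definition smooth_on U f :=
  forall (s : seq 'I_4) x, U x -> differentiable (pds s f) x.

Definition vsmooth_on U F := forall i : 'I_4, smooth_on U (fun x => F x 0 i).

(* Row-vector convention: row i holds the i-th partial derivatives, so
   (jac F x) i a = d F^a / d x^i. *)
Definition jac F x : 'M[R]_4 := \matrix_(i, a) pd i (fun z => F z 0 a) x.

(* f = O_oo(|x|^-k) at infinity. *)
Definition bigO_infty (k : R) f :=
  forall s : seq 'I_4, exists C rho : R,
    forall x, rho < enorm x ->
      `|pds s f x| <= C * enorm x `^ (- k - (size s)%:R).

(* Iterated Lebesgue integral over R^4; by Tonelli it is the Lebesgue integral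
   for the non-negative Borel functions it is used with. *)
Definition integral4 (f : E4 -> \bar R) : \bar R :=
  (\int[lebesgue_measure]_a \int[lebesgue_measure]_b
   \int[lebesgue_measure]_c \int[lebesgue_measure]_d
     f (\row_(i < 4) [:: a; b; c; d]`_i))%E.

(* Unit vector with hyperspherical angles a, b in [0, pi], c in [0, 2 pi]. *)
Definition sphere_pt (a b c : R) : E4 :=
  \row_(i < 4) [:: cos a; sin a * cos b; sin a * sin b * cos c;
                  sin a * sin b * sin c]`_i.

(* Integral over the Euclidean sphere S_r of x |-> h x nu, with nu = x / r;
   the area element is r^3 sin^2 a sin b da db dc. *)
Definition sphere_integral (r : R) (h : E4 -> E4 -> R) : R :=
  \int[lebesgue_measure]_(a in `[0, pi]) \int[lebesgue_measure]_(b in `[0, pi])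
  \int[lebesgue_measure]_(c in `[0, 2 * pi])
    (h (r *: sphere_pt a b c) (sphere_pt a b c)
       * (r ^+ 3 * sin a ^+ 2 * sin b)).

End Euclidean.

Section LocalGeometry.
Variable R : realType.
Local Notation E4 := 'rV[R]_4.
Local Notation tensor4 := ('I_4 -> 'I_4 -> 'I_4 -> 'I_4 -> R).
Implicit Types (G : E4 -> 'M[R]_4) (x : E4) (i j k l : 'I_4).

(* Throughout, G is a metric in coordinates. *)

Definition ginv G x : 'M[R]_4 := invmx (G x).

(* Gamma^k_{ij} *)
Definition christoffel G k i j x : R :=
  2^-1 * \sum_l ginv G x k l *
    (pd i (fun z => G z j l) x + pd j (fun z => G z i l) x
     - pd l (fun z => G z i j) x).

(* R(d_i, d_j) d_k = \sum_l (curv G i j k l x) d_l. *)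
Definition curv G i j k l x : R :=
  pd i (christoffel G l j k) x - pd j (christoffel G l i k) x
  + \sum_m (christoffel G l i m x * christoffel G m j k x
            - christoffel G l j m x * christoffel G m i k x).

(* Rm_{ijkl} = g(R(d_i, d_j) d_k, d_l), so Rm_{ijji} > 0 on round spheres. *)
Definition Rm G i j k l x : R := \sum_m G x l m * curv G i j k m x.

Definition Ric G j k x : R := \sum_i \sum_l ginv G x i l * Rm G i j k l x.

Definition scal G x : R := \sum_j \sum_k ginv G x j k * Ric G j k x.

Definition Rm_normsq G x : R :=
  \sum_i \sum_j \sum_k \sum_l \sum_a \sum_b \sum_c \sum_d
    ginv G x i a * ginv G x j b * ginv G x k c * ginv G x l d
    * Rm G i j k l x * Rm G a b c d x.

(* Weyl tensor in dimension 4. *)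
Definition Weyl G i j k l x : R :=
  Rm G i j k l x
  - 2^-1 * (G x i l * Ric G j k x + G x j k * Ric G i l x
            - G x i k * Ric G j l x - G x j l * Ric G i k x)
  + 6^-1 * scal G x * (G x i l * G x j k - G x i k * G x j l).

Definition levi_civita i j k l : R :=
  \det (\matrix_(a < 4, b < 4) ([:: i; j; k; l]`_a == b)%:R).

(* Hodge star on the first pair of indices of the Weyl tensor, for the
   volume form eps sqrt(det g) dx^1 /\ ... /\ dx^4, eps = 1 or -1. *)
Definition star_Weyl (eps : R) G i j k l x : R :=
  2^-1 * \sum_a \sum_b \sum_c \sum_d
    eps * Num.sqrt (\det (G x)) * levi_civita i j a b
    * ginv G x a c * ginv G x b d * Weyl G c d k l x.

(* nabla_m Rm_{ijkl} *)
Definition nabla_Rm G m i j k l x : R :=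
  pd m (Rm G i j k l) x
  - \sum_a (christoffel G a m i x * Rm G a j k l x
            + christoffel G a m j x * Rm G i a k l x
            + christoffel G a m k x * Rm G i j a l x
            + christoffel G a m l x * Rm G i j k a x).

Definition div_Rm G j k l x : R :=
  \sum_m \sum_i ginv G x m i * nabla_Rm G m i j k l x.

Definition pullback_mx (F : E4 -> E4) G x : 'M[R]_4 :=
  jac F x *m G (F x) *m (jac F x)^T.

Definition Xi (lambda : R) : tensor4 := fun i j k l =>
  - (lambda / 9) * (i == j)%:R * (k == l)%:R
  + 2 * lambda / 9 * ((i == k)%:R * (j == l)%:R + (i == l)%:R * (j == k)%:R).

Record algebraic_weyl (W : tensor4) : Prop := AlgebraicWeyl {
  weyl_anti12 : forall i j k l, W j i k l = - W i j k l;
  weyl_anti34 : forall i j k l, W i j l k = - W i j k l;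
  weyl_pair : forall i j k l, W k l i j = W i j k l;
  weyl_bianchi : forall i j k l, W i j k l + W j k i l + W k i j l = 0;
  weyl_trace12 : forall k l, \sum_a W a a k l = 0;
  weyl_trace13 : forall j l, \sum_a W a j a l = 0;
  weyl_trace14 : forall j k, \sum_a W a j k a = 0;
  weyl_trace23 : forall i l, \sum_a W i a a l = 0;
  weyl_trace24 : forall i k, \sum_a W i a k a = 0;
  weyl_trace34 : forall i j, \sum_a W i j a a = 0 }.

(* G_ij = delta_ij + (Xi(lambda)_ijkl + W_iklj) x_k x_l / |x|^4
          + O_oo(|x|^(-2-sigma)) *)
Definition metric_expansion (lambda sigma : R) (W : tensor4) G :=
  forall i j, bigO_infty (2 + sigma) (fun x =>
    G x i j - ((i == j)%:R
      + \sum_k \sum_l (Xi lambda i j k l + W i k l j)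
                      * (x 0 k * x 0 l / enorm x ^+ 4))).

Definition sch_metric (mS : R) x : 'M[R]_4 :=
  ((1 + mS / (2 * enorm x ^+ 2)) ^+ 2)%:M.

Definition sch_map (mS : R) x : E4 := x - (mS / enorm x ^+ 2) *: x.

Definition sch_sharp (mS : R) : E4 -> 'M[R]_4 :=
  pullback_mx (sch_map mS) (sch_metric mS).

(* The reference metric is defined near infinity only, so the gauge condition
   is imposed outside some ball. *)
Definition relative_gauge (mS : R) G :=
  exists rho : R, forall x, rho < enorm x -> forall k,
    \sum_i \sum_j ginv G x i j *
      (christoffel G k i j x - christoffel (sch_sharp mS) k i j x) = 0.

Definition mass_flux G (r : R) : R :=
  sphere_integral r (fun x nu => \sum_i \sum_j
    (pd j (fun z => G z i j) x - pd i (fun z => G z j j) x) * nu 0 i).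

(* gtilde is the metric on the cover and N = |Gamma|; omega_3 = 2 pi^2. *)
Definition adm_mass (N : nat) (gtilde : E4 -> 'M[R]_4) : R :=
  (6 * (2 * pi ^+ 2) * N%:R)^-1
  * lim (mass_flux gtilde r @[r --> +oo]).

End LocalGeometry.

Section Manifolds.
Variable R : realType.
Local Notation E4 := 'rV[R]_4.

Record chart (M : topologicalType) := Chart {
  dom : set M;
  cmap : M -> E4;
  cinv : E4 -> M;
  dom_open : open dom;
  cod_open : open (cmap @` dom);
  cmapK : forall p, dom p -> cinv (cmap p) = p;
  cmap_cont : forall p, dom p -> {for p, continuous cmap};
  cinv_cont : forall x, (cmap @` dom) x -> {for x, continuous cinv} }.

(* The atlas is indexed by the points of M, with chart_at p a chart around p;
   every smooth structure has an atlas of this form. *)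
Record manifold4 (M : topologicalType) := Manifold4 {
  chart_at : M -> chart M;
  chart_at_dom : forall p, dom (chart_at p) p;
  mfd_hausdorff : hausdorff_space M;
  mfd_second_countable : @second_countable M;
  mfd_compat : forall p q,
    vsmooth_on (cmap (chart_at p) @` (dom (chart_at p) `&` dom (chart_at q)))
               (cmap (chart_at q) \o cinv (chart_at p)) }.

(* metric p is the matrix of g in the coordinates chart_at p. *)
Record riemannian4 (M : topologicalType) := Riemannian4 {
  mfd :> manifold4 M;
  metric : M -> E4 -> 'M[R]_4;
  metric_smooth : forall p (i j : 'I_4),
    smooth_on (cmap (chart_at mfd p) @` dom (chart_at mfd p))
              (fun x => metric p x i j);
  metric_sym : forall p x, (cmap (chart_at mfd p) @` dom (chart_at mfd p)) x ->
    (metric p x)^T = metric p x;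
  metric_pos : forall p x, (cmap (chart_at mfd p) @` dom (chart_at mfd p)) x ->
    forall v : E4, v != 0 -> 0 < (v *m metric p x *m v^T) 0 0;
  metric_compat : forall p q x,
    (cmap (chart_at mfd p) @`
       (dom (chart_at mfd p) `&` dom (chart_at mfd q))) x ->
    metric p x =
    pullback_mx (cmap (chart_at mfd q) \o cinv (chart_at mfd p)) (metric q) x }.

(* ptopologicalType: measurable types have to be pointed, that is non-empty. *)
Section Geometry.
Variables (M : ptopologicalType) (g : riemannian4 M).
Local Notation phi p := (cmap (chart_at g p)).
Local Notation psi p := (cinv (chart_at g p)).
Local Notation dm p := (dom (chart_at g p)).

Definition smooth_into (U : set E4) (F : E4 -> M) :=
  (forall x, U x -> {for x, continuous F}) /\
  (forall p, vsmooth_on (U `&` F @^-1` dm p) (phi p \o F)).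

(* F^* g in the standard coordinates; only used where F is smooth. *)
Definition pullback (F : E4 -> M) (x : E4) : 'M[R]_4 :=
  let J := jac (phi (F x) \o F) x in
  J *m metric g (F x) (phi (F x) (F x)) *m J^T.

Definition C1_curve (c : R -> M) :=
  continuous c /\
  forall p (i : 'I_4) (t : R), dm p (c t) ->
    derivable (fun s => phi p (c s) 0 i) t 1 /\
    {for t, continuous (derive1 (fun s => phi p (c s) 0 i))}.

Definition velocity (c : R -> M) (t : R) : E4 :=
  \row_i derive1 (fun s => phi (c t) (c s) 0 i) t.

Definition speed (c : R -> M) (t : R) : R :=
  Num.sqrt ((velocity c t *m metric g (c t) (phi (c t) (c t))
             *m (velocity c t)^T) 0 0).

(* Infimum of lengths of C^1 curves; velocities may vanish, so piecewise C^1
   curves can be reparametrized to be of this form.  The distance is +oo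
   between different components. *)
Definition rdist (p q : M) : \bar R :=
  ereal_inf [set L | exists c : R -> M,
    [/\ C1_curve c, c 0 = p, c 1 = q &
        L = (\int[lebesgue_measure]_(t in `[0%R, 1%R]) (speed c t)%:E)%E]].

Definition rcomplete :=
  forall u : nat -> M,
    (forall e : R, 0 < e -> exists N : nat, forall m n : nat,
       (N <= m)%N -> (N <= n)%N -> (rdist (u m) (u n) < e%:E)%E) ->
    exists p : M, u @ \oo --> p.

Definition rlipschitz (f : M -> R) :=
  exists2 K : R, 0 < K &
    forall p q, ((`|f p - f q|)%:E <= K%:E * rdist p q)%E.

Local Notation borelM := (g_sigma_algebraType (@open M)).

(* mu is the Riemannian volume dV_g = sqrt(det g) dx. *)
Definition riemannian_volume (mu : {measure set borelM -> \bar R}) :=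
  forall p (A : set borelM), measurable A -> A `<=` dm p ->
    mu A = integral4 (fun x =>
      (Num.sqrt (\det (metric g p x)) * \1_(phi p @` A) x)%:E).

(* |nabla f|.  For a Lipschitz f it is only meaningful almost everywhere, where
   f is differentiable. *)
Definition grad_norm (f : M -> R) (p : M) : R :=
  Num.sqrt (\sum_(i < 4) \sum_(j < 4) ginv (metric g p) (phi p p) i j
    * pd i (f \o psi p) (phi p p) * pd j (f \o psi p) (phi p p)).

Definition sobolev_finite (mu : {measure set borelM -> \bar R}) :=
  exists C : R, forall f : M -> R,
    compact (closure [set p | f p != 0]) -> rlipschitz f ->
    (Lnorm mu 4%:E (EFin \o f) <= C%:E * Lnorm mu 2%:E (EFin \o grad_norm f))%E.

(* An orientation is a locally constant choice of sign in every chart; the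
   volume form in the chart p is then eps p * sqrt (det g). *)
Definition orientation (eps : M -> M -> R) :=
  (forall p q, dm p q ->
     (eps p q = 1 \/ eps p q = -1) /\ \forall q' \near q, eps p q' = eps p q)
  /\ (forall p p' q, dm p q -> dm p' q ->
        eps p q = Num.sg (\det (jac (phi p' \o psi p) (phi p q))) * eps p' q).

Definition self_dual (eps : M -> M -> R) :=
  forall p i j k l, star_Weyl (eps p p) (metric g p) i j k l (phi p p)
                    = Weyl (metric g p) i j k l (phi p p).

Definition anti_self_dual (eps : M -> M -> R) :=
  forall p i j k l, star_Weyl (eps p p) (metric g p) i j k l (phi p p)
                    = - Weyl (metric g p) i j k l (phi p p).

Definition harmonic_curvature :=
  forall p j k l, div_Rm (metric g p) j k l (phi p p) = 0.

End Geometry.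

(* Singular homology with real coefficients. *)
Section SingularHomology.
Variable M : topologicalType.

Definition simplex (n : nat) : set 'rV[R]_n.+1 :=
  [set x | (forall i, 0 <= x 0 i) /\ \sum_i x 0 i = 1].

(* Formal sums of n-simplices; only the values on the standard simplex matter,
   and two formal sums are the same chain when all coefficients agree. *)
Definition chain (n : nat) := seq (R * ('rV[R]_n.+1 -> M)).

Definition singular n (c : chain n) :=
  forall a, a \in c -> {within @simplex n, continuous a.2}.

Definition coef n (c : chain n) (s : 'rV[R]_n.+1 -> M) : R :=
  \sum_(a <- c | `[< forall x, simplex x -> a.2 x = s x >]) a.1.

(* Inserts 0 as the i-th barycentric coordinate. *)
Definition face_map n (i : 'I_n.+2) (x : 'rV[R]_n.+1) : 'rV[R]_n.+2 :=
  \row_j (if unlift i j is Some k then x 0 k else 0).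

Definition boundary n (c : chain n.+1) : chain n :=
  [seq ((-1) ^+ i * a.1, a.2 \o @face_map n i)
     | a : R * ('rV[R]_n.+2 -> M) <- c, i : 'I_n.+2 <- enum 'I_n.+2].

Definition cycle n (c : chain n.+1) :=
  singular c /\ forall s, coef (boundary c) s = 0.

(* H_{n+1}(M; R) is finite dimensional: finitely many cycles span all cycles
   modulo boundaries. *)
Definition betti_finite (n : nat) :=
  exists (k : nat) (z : 'I_k -> chain n.+1),
    (forall i, cycle (z i)) /\
    forall c, cycle c -> exists (a : 'I_k -> R) (b : chain n.+2),
      singular b /\
      forall s, coef c s = \sum_(i < k) a i * coef (z i) s
                           + coef (boundary b) s.

End SingularHomology.

Section TV.
Variables (M : ptopologicalType) (g : riemannian4 M).
Local Notation borelM := (g_sigma_algebraType (@open M)).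
Local Notation phi p := (cmap (chart_at g p)).

Record TV_hypotheses (mu : {measure set borelM -> \bar R}) : Prop :=
  TVHypotheses {
    TV_scalar_flat : forall p, scal (metric g p) (phi p p) = 0;
    TV_L2_curvature :
      (\int[mu]_p (Rm_normsq (metric g p) (phi p p))%:E < +oo)%E;
    TV_sobolev : sobolev_finite g mu;
    TV_betti1 : betti_finite M 0;
    TV_curvature :
      (exists eps, orientation g eps /\
         (self_dual g eps \/ anti_self_dual g eps))
      \/ harmonic_curvature g }.

(* An end: an unbounded component of the complement of a compact set. *)
Definition is_end (Omega : set M) :=
  exists (K : set M) (p : M),
    [/\ compact K, (~` K) p, Omega = connected_component (~` K) p
      & ~ compact (closure Omega)].

(* A finite subgroup of SO(4), acting by x |-> A x, that is x *m A^T on row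
   vectors. *)
Definition finite_subgroup_SO4 (Gam : {fset 'M[R]_4}) :=
  [/\ 1%:M \in Gam,
      forall A B, A \in Gam -> B \in Gam -> A *m B \in Gam,
      forall A, A \in Gam -> invmx A \in Gam &
      forall A, A \in Gam -> A *m A^T = 1%:M /\ \det A = 1].

(* A diffeomorphism Phi : Omega -> (R^4 \ B_R) / Gamma is given by the
   covering ale_cover = Phi^-1 o quotient : R^4 \ B_R -> Omega, a smooth local
   diffeomorphism onto Omega whose fibres are the Gamma-orbits.  The Gamma-cover
   of Omega is then R^4 \ B_R, with covering map ale_cover. *)
Record ale_end (tau : R) := AleEnd {
  ale_set : set M;
  ale_group : {fset 'M[R]_4};
  ale_radius : R;
  ale_cover : E4 -> M;
  ale_is_end : is_end ale_set;
  ale_radius_gt0 : 0 < ale_radius;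
  ale_subgroup : finite_subgroup_SO4 ale_group;
  ale_free : forall A x, A \in ale_group -> exterior ale_radius x ->
    x *m A^T = x -> A = 1%:M;
  ale_smooth : smooth_into g (exterior ale_radius) ale_cover;
  ale_local_diffeo : forall x, exterior ale_radius x ->
    jac (phi (ale_cover x) \o ale_cover) x \in unitmx;
  ale_onto : ale_cover @` exterior ale_radius = ale_set;
  ale_fibres : forall x y, exterior ale_radius x -> exterior ale_radius y ->
    (ale_cover x = ale_cover y <-> exists2 A, A \in ale_group & y = x *m A^T);
  ale_decay : forall i j, bigO_infty tau (fun x =>
    pullback g ale_cover x i j - (i == j)%:R) }.

End TV.

(* Coordinates on the cover {|z| > r0} identifying a neighbourhood of infinity
   with the exterior of a ball, infinity corresponding to infinity. *)
Record end_coords (r0 : R) := EndCoords {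
  ec_dom : set E4;
  ec_radius : R;
  ec_map : E4 -> E4;
  ec_inv : E4 -> E4;
  ec_dom_open : open ec_dom;
  ec_dom_sub : ec_dom `<=` exterior r0;
  ec_dom_infty : exists rho : R, exterior rho `<=` ec_dom;
  ec_radius_gt0 : 0 < ec_radius;
  ec_mapP : forall z, ec_dom z -> exterior ec_radius (ec_map z);
  ec_invP : forall x, exterior ec_radius x -> ec_dom (ec_inv x);
  ec_mapK : forall z, ec_dom z -> ec_inv (ec_map z) = z;
  ec_invK : forall x, exterior ec_radius x -> ec_map (ec_inv x) = x;
  ec_map_smooth : vsmooth_on ec_dom ec_map;
  ec_inv_smooth : vsmooth_on (exterior ec_radius) ec_inv;
  ec_map_infty : forall C : R, exists rho : R,
    forall z, ec_dom z -> rho < enorm z -> C < enorm (ec_map z);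
  ec_inv_infty : forall C : R, exists rho : R,
    forall x, exterior ec_radius x -> rho < enorm x -> C < enorm (ec_inv x) }.

Section Masses.
Variables (M : ptopologicalType) (g : riemannian4 M) (tau : R).
Variable E : ale_end g tau.

Definition group_order : nat := #|` ale_group E|%fset.

Definition end_mass : R := adm_mass group_order (pullback g (ale_cover E)).

(* g in the coordinates c on the cover. *)
Definition coord_metric (c : end_coords (ale_radius E)) : E4 -> 'M[R]_4 :=
  pullback g (ale_cover E \o ec_inv c).

End Masses.
End Manifolds.

(* Main.v *)
(* Let F be the change between the two coordinate systems, so that the metric in
   x is the pullback under F of the metric in y.  The Koszul formula expresses
   the second derivatives of F by first derivatives of the two metrics, hence
   D^2 F = O(|x|^-3), and integration along rays gives F(x) = xA + c + O(1/|x|)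
   (row vectors) with A orthogonal.  Let h(x) = O(|x|^-2) be the leading term of
   the metric in x minus that of the metric in y rotated by A.  By the Koszul
   formula, t^2 (DF(tx) - A) converges to V(x) = h(x) A / 2 along every ray.  The
   Weyl terms are annihilated by x and the Xi terms are rotation invariant, so
   x h(x) = 0, and integrating once more t (F(tx) - txA - c) -> 0 pointwise.  As
   t^3 D^2 F(tx) stays bounded, this forces V = 0 and h = 0.  Finally
   W_{iklj} x_k x_l determines W by polarization and the Bianchi identity. *)
Require Import Defs.
From HB Require Import structures.
From mathcomp Require Import all_boot all_order all_algebra finmap.
From mathcomp Require Import all_classical all_reals all_analysis.
From mathcomp Require Import ring lra.
Set Implicit Arguments.
Unset Strict Implicit.
Unset Printing Implicit Defensive.
Import Order.TTheory GRing.Theory Num.Theory.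
Import numFieldNormedType.Exports.
Local Open Scope classical_set_scope.
Local Open Scope ring_scope.

(** Behind the ray argument is a linear fact. Let u be a vector field homogeneous of degree -1 and
    h_jk = d_j u_k + d_k u_j, with x h = 0. The Koszul formula contracted with x gives - h_jk for
    the radial derivative of d_j u_k, which by homogeneity is - 2 d_j u_k; so d_j u_k = h_jk / 2,
    and then - u_k = x_j d_j u_k = 0. The obstacle is that no expansion of F with such a term u is
    available to be differentiated: there are only a bound on D^2 F and limits along single rays,
    without uniformity in the direction. Radial information is integrated in from infinity, but
    transversal derivatives have to be recovered by interpolation. A second difficulty sits in the
    bound on D^2 F: the metric in y is evaluated at F(x), so its decay in |F(x)| must be converted
    into decay in |x|. This is why the inverse map H and its linear growth are carried along. *)

Lemma cvg_sumr {R : realType} {T : Type} (F : set_system T) {FF : Filter F} n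
    (f : 'I_n -> T -> R) (l : 'I_n -> R) : (forall i, f i t @[t --> F] --> l i) ->
  \sum_i f i t @[t --> F] --> \sum_i l i.
Proof.
move=> fl; apply: cvg_big => [[a b]|i _]; last exact: fl.
by apply: cvgD; [exact: cvg_fst|exact: cvg_snd].
Qed.

(** * Euclidean norm and partial derivatives *)

Section EuclideanNorm.
Context {R : realType}.
Local Notation E4 := 'rV[R]_4.
Implicit Types (x y v : E4) (t : R).

Definition dotp x y : R := \sum_i x 0 i * y 0 i.

Lemma enorm_ge0 x : 0 <= enorm x.
Proof. exact: sqrtr_ge0. Qed.

Lemma enorm_sqr x : enorm x ^+ 2 = dotp x x.
Proof.
rewrite sqr_sqrtr; first by apply: eq_bigr => i _; rewrite expr2.
by apply: sumr_ge0 => i _; exact: sqr_ge0.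
Qed.

Lemma coord_le_enorm x i : `|x 0 i| <= enorm x.
Proof.
rewrite -sqrtr_sqr ler_wsqrtr// (bigD1 i)//= lerDl.
by apply: sumr_ge0 => j _; exact: sqr_ge0.
Qed.

Lemma enormZ t x : enorm (t *: x) = `|t| * enorm x.
Proof.
rewrite /enorm (eq_bigr (fun i => t ^+ 2 * x 0 i ^+ 2)).
  by rewrite -mulr_sumr sqrtrM ?sqr_ge0// sqrtr_sqr.
by move=> i _; rewrite mxE exprMn.
Qed.

Lemma enorm0 : enorm (0 : E4) = 0.
Proof. by rewrite -(scale0r 0) enormZ normr0 mul0r. Qed.

Lemma enorm_gt0 x : x != 0 -> 0 < enorm x.
Proof.
move=> x0; rewrite lt_neqAle enorm_ge0 andbT eq_sym; apply: contra x0 => /eqP e0.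
apply/eqP/rowP => i; rewrite mxE; apply/eqP.
by rewrite -normr_le0 -e0 coord_le_enorm.
Qed.

(** The factor 2 is the square root of the dimension 4. *)
Lemma enorm_le (B : R) x : (forall i, `|x 0 i| <= B) -> enorm x <= 2 * B.
Proof.
move=> xB; have B0 : 0 <= B by apply: le_trans (xB 0); exact: normr_ge0.
rewrite -(@ler_pXn2r _ 2)// ?nnegrE ?enorm_ge0 ?mulr_ge0//.
rewrite enorm_sqr (le_trans (ler_sum _ (G := fun=> B ^+ 2) _))//.
  by move=> i _; rewrite -expr2 -real_normK ?num_real// lerXn2r ?nnegrE.
by rewrite sumr_const card_ord -mulr_natr; lra.
Qed.

Lemma continuous_enorm : continuous (@enorm R).
Proof.
move=> x; apply: (@continuous_comp _ _ _ (fun z : E4 => \sum_i z 0 i ^+ 2) Num.sqrt).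
  apply: (@cvg_sumr _ _ (nbhs x) (nbhs_filter x)) => i.
  apply: (@continuous_comp _ _ _ (fun z : E4 => z 0 i) (fun r => r ^+ 2)).
    exact: coord_continuous.
  exact: exprn_continuous.
exact: sqrt_continuous.
Qed.

Lemma open_exterior r : open (@exterior R r).
Proof.
apply: (@open_comp _ _ (@enorm R) [set z | r < z]); last exact: open_gt.
by move=> x _; exact: continuous_enorm.
Qed.

Lemma near_exterior (r : R) x : r < enorm x -> \forall z \near x, r < enorm z.
Proof. by move=> rx; apply: open_nbhs_nbhs; split => //; exact: open_exterior. Qed.

Lemma dotp_mulmx x y (A : 'M[R]_4) : dotp x (y *m A) = dotp (x *m A^T) y.
Proof.
rewrite /dotp.
under eq_bigr do rewrite mxE mulr_sumr.
rewrite exchange_big /=; apply: eq_bigr => i _.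
rewrite mxE mulr_suml; apply: eq_bigr => j _; rewrite mxE; ring.
Qed.

Lemma enorm_orth x (A : 'M[R]_4) : A *m A^T = 1%:M -> enorm (x *m A) = enorm x.
Proof.
move=> AA; apply/eqP; rewrite -(@eqrXn2 _ 2)// ?enorm_ge0//.
by rewrite !enorm_sqr dotp_mulmx -mulmxA AA mulmx1.
Qed.

Lemma dotpDZ x y t : dotp (x + t *: y) (x + t *: y)
  = dotp x x + 2 * t * dotp x y + t ^+ 2 * dotp y y.
Proof.
rewrite /dotp !mulr_sumr -!big_split /=; apply: eq_bigr => i _.
rewrite !mxE; ring.
Qed.

End EuclideanNorm.

(** * Chain rule, mean values along lines, symmetry of second derivatives *)

Section Calculus.
Context {R : realType}.
Local Notation E4 := 'rV[R]_4.
Implicit Types (x p v : E4) (f : E4 -> R) (F : E4 -> E4).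

Lemma derive_pd f x v : differentiable f x ->
  'D_v f x = \sum_j v 0 j * pd j f x.
Proof.
move=> df; rewrite deriveE// {1}(row_sum_delta v) linear_sum.
by apply: eq_bigr => j _; rewrite linearZ /= /pd deriveE.
Qed.

Lemma is_derive_line f p v (s : R) : differentiable f (p + s *: v) ->
  is_derive s 1 (fun s => f (p + s *: v)) ('D_v f (p + s *: v)).
Proof.
move=> df.
have dv : derivable f (p + s *: v) v by exact: diff_derivable.
have E : (fun h : R => h^-1 *: (((fun s => f (p + s *: v)) \o shift s) (h *: 1)
                            - f (p + s *: v)))
      = (fun h => h^-1 *: ((f \o shift (p + s *: v)) (h *: v) - f (p + s *: v))).
  apply/funext => h /=; congr (_ *: (f _ - _)).
  by rewrite [h *: 1]mulr1 scalerDl addrCA.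
by split; rewrite /derivable /derive /= E.
Qed.

Lemma mvt_line f p v : (forall s, 0 <= s <= 1 -> differentiable f (p + s *: v)) ->
  exists2 s, 0 <= s <= 1 &
    f (p + v) - f p = \sum_j v 0 j * pd j f (p + s *: v).
Proof.
move=> df.
have [||s] := @MVT_segment R (fun s => f (p + s *: v))
    (fun s => 'D_v f (p + s *: v)) 0 1 ler01.
- by move=> s; rewrite in_itv /= => /andP[s0 s1]; apply/is_derive_line/df; rewrite !ltW.
- apply: derivable_within_continuous => s; rewrite in_itv /= => s01.
  by have [] := is_derive_line (df s s01).
- rewrite in_itv /= => s01; rewrite scale1r scale0r addr0 subr0 mulr1.
  by rewrite derive_pd; [exists s|exact: df].
Qed.

Lemma differentiable_vec F x :
  (forall i, differentiable (fun z => F z 0 i) x) -> differentiable F x.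
Proof.
move=> dF; rewrite (_ : F = \sum_i (fun z => F z 0 i *: delta_mx 0 i)).
  by apply: differentiable_sum => i; exact: differentiableZl.
by apply/funext => z; rewrite fct_sumE -row_sum_delta.
Qed.

Lemma pd_comp f F x i : differentiable f (F x) ->
  (forall j, differentiable (fun z => F z 0 j) x) ->
  pd i (f \o F) x = \sum_j pd i (fun z => F z 0 j) x * pd j f (F x).
Proof.
move=> df dF; have dF' := differentiable_vec dF.
rewrite /pd deriveE; last exact: differentiable_comp.
rewrite diff_comp//= -deriveE// derive_pd//; apply: eq_bigr => j _.
rewrite -deriveE// derive_mx ?mxE//; exact: diff_derivable.
Qed.


Lemma diff_eps f x (e : R) : differentiable f x -> 0 < e ->
  exists2 d, 0 < d & forall v, `|v| < d ->
    `|f (x + v) - f x - 'D_v f x| <= e * `|v|.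
Proof.
move=> df e0; have /diff_locally := df.
move=> /eqaddoP /(_ e e0); rewrite near_simpl => /nbhs_normP[d /= d0 dP].
exists d => // v vd.
have := dP v; rewrite /= sub0r normrN => /(_ vd).
by rewrite deriveE//= !fctE /= opprD addrA [v + x]addrC.
Qed.

(* Both mixed partials are limits of the same second difference quotient. *)
Lemma second_difference f x i j (e : R) : (\forall z \near x, differentiable f z) ->
  differentiable (pd i f) x -> 0 < e ->
  \forall h \near 0^'+, `|f (x + h *: delta_mx 0 i + h *: delta_mx 0 j)
    - f (x + h *: delta_mx 0 i) - f (x + h *: delta_mx 0 j) + f x
    - h ^+ 2 * pd j (pd i f) x| <= 3 * e * h ^+ 2.
Proof.
move=> /nbhs_normP[r /= r0 dfr] dg e0.
have [d d0 dP] := diff_eps dg e0.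
near=> h.
have h0 : 0 < h by near: h; exact: nbhs_right_gt.
have h2r : 2 * h < r by rewrite -ltr_pdivlMl//; near: h; apply: nbhs_right_lt; lra.
have h2d : 2 * h < d by rewrite -ltr_pdivlMl//; near: h; apply: nbhs_right_lt; lra.
have nd k : `|delta_mx 0 k : E4| <= 1.
  rewrite [leLHS]/Num.Def.normr/= mx_normrE; apply: bigmax_le => // -[a b] _.
  by rewrite mxE /=; case: (_ && _); rewrite ?normr1 ?normr0.
have nsd (s : R) k : 0 <= s <= h -> `|s *: delta_mx 0 k : E4| <= h.
  move=> /andP[s0 sh]; rewrite normrZ ger0_norm// (le_trans _ sh)//.
  by rewrite -[leRHS]mulr1 ler_wpM2l.
have hh : 0 <= h <= h by rewrite lexx ltW.
have df1 s : 0 <= s <= h -> differentiable f (x + s *: delta_mx 0 i).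
  move=> sh; apply: dfr; rewrite /= opprD addrA subrr sub0r normrN.
  by rewrite (le_lt_trans (nsd _ _ sh))//; lra.
have nsd2 s : 0 <= s <= h -> `|h *: delta_mx 0 j + s *: delta_mx 0 i : E4| <= 2 * h.
  move=> sh; rewrite (le_trans (ler_normD _ _))//.
  by have := nsd _ i sh; have := nsd _ j hh; lra.
have df2 s : 0 <= s <= h ->
    differentiable f ((x + h *: delta_mx 0 j) + s *: delta_mx 0 i).
  move=> sh; apply: dfr; rewrite /= -addrA opprD addrA subrr sub0r normrN.
  by rewrite (le_lt_trans (nsd2 _ sh)).
(* The mean value theorem in direction [i], applied to the difference of two parallel segments,
   turns the second difference into [h] times an increment of [g] between points at distance at most
   [2 * h] and [h] from [x]. Expanding [g] at [x] costs [e * (2 * h) + e * h], hence the factor 3;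
   the [i]-th derivatives of [g] cancel. *)
pose g := pd i f.
have [||s] := @MVT_segment R (fun s => f ((x + h *: delta_mx 0 j) + s *: delta_mx 0 i)
      - f (x + s *: delta_mx 0 i))
    (fun s => g ((x + h *: delta_mx 0 j) + s *: delta_mx 0 i)
      - g (x + s *: delta_mx 0 i)) 0 h (ltW h0).
- move=> s; rewrite in_itv /= => /andP[s0 sh].
  have sh' : 0 <= s <= h by rewrite !ltW.
  by apply: is_deriveB; apply: is_derive_line; [exact: df2|exact: df1].
- apply: derivable_within_continuous => s; rewrite in_itv /= => sh.
  by apply: derivableB; [have [] := is_derive_line (df2 _ sh)
    |have [] := is_derive_line (df1 _ sh)].
- rewrite in_itv /= => sh; rewrite !scale0r !addr0 subr0 => E.
  have -> : f (x + h *: delta_mx 0 i + h *: delta_mx 0 j)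
     - f (x + h *: delta_mx 0 i) - f (x + h *: delta_mx 0 j) + f x =
     (g ((x + h *: delta_mx 0 j) + s *: delta_mx 0 i)
      - g (x + s *: delta_mx 0 i)) * h.
    by rewrite -E [x + h *: delta_mx 0 i + _]addrAC; ring.
  have lt2 := dP _ (le_lt_trans (nsd2 _ sh) h2d).
  have lt1 : `|s *: delta_mx 0 i : E4| < d.
    by rewrite (le_lt_trans (nsd _ _ sh))//; lra.
  move: lt1 => /dP lt1.
  have D2 : 'D_(h *: delta_mx 0 j + s *: delta_mx 0 i) g x
     = h * pd j g x + s * pd i g x.
    by rewrite deriveE// linearD !linearZ /pd !deriveE.
  have D1 : 'D_(s *: delta_mx 0 i) g x = s * pd i g x.
    by rewrite deriveE// linearZ /pd !deriveE.
  move: lt2 lt1; rewrite addrA D2 D1 -/g => lt2 lt1.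
  have b2 := ler_wpM2l (ltW e0) (nsd2 _ sh).
  have b1 := ler_wpM2l (ltW e0) (nsd _ i sh).
  move: (le_trans lt2 b2) (le_trans lt1 b1).
  set X2 := g (x + _ + _); set X1 := g (x + _); set G := g x.
  set gj := pd j g x; set gi := pd i g x => H2 H1.
  have -> : (X2 - X1) * h - h ^+ 2 * gj
     = h * ((X2 - G - (h * gj + s * gi)) - (X1 - G - s * gi)) by ring.
  rewrite normrM gtr0_norm// expr2 mulrCA ler_pM2l//.
  rewrite (le_trans (ler_normB _ _))// (le_trans (lerD H2 H1))//.
  by rewrite le_eqVlt; apply/orP; left; apply/eqP; ring.
Unshelve. all: by end_near. Qed.

Lemma pd_comm f x i j : (\forall z \near x, differentiable f z) ->
  differentiable (pd i f) x -> differentiable (pd j f) x ->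
  pd i (pd j f) x = pd j (pd i f) x.
Proof.
move=> df di dj; apply/eqP; rewrite -subr_eq0 -normr_le0; apply/ler_addgt0Pr => e e0.
rewrite add0r.
(* Each of the two estimates costs [3 * (e / 6) * h ^+ 2]; together they cost [e * h ^+ 2]. *)
have e6 : 0 < e / 6 by rewrite divr_gt0.
have : \forall h \near (0:R)^'+, `|pd i (pd j f) x - pd j (pd i f) x| <= e.
  have N1 := second_difference j df di e6.
  have N2 := second_difference i df dj e6.
  apply: filterS3 (nbhs_right_gt 0) N1 N2 => h h0 H1 H2.
  rewrite -(@ler_pM2l _ (h ^+ 2)) ?exprn_gt0//.
  rewrite -[h ^+ 2 in leLHS]ger0_norm ?sqr_ge0// -normrM mulrBr.
  move: H2 H1; rewrite [x + _ + _]addrAC.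
  set X := f (x + _ + _); set Y := f _; set Z := f _; set W := f _.
  set P := pd i (pd j f) x; set Q := pd j (pd i f) x => H1 H2.
  clearbody X Y Z W P Q.
  have -> : h ^+ 2 * P - h ^+ 2 * Q =
    (X - Z - Y + W - h ^+ 2 * Q) - (X - Y - Z + W - h ^+ 2 * P) by ring.
  rewrite (le_trans (ler_normB _ _))// (le_trans (lerD H2 H1))//.
  by rewrite le_eqVlt; apply/orP; left; apply/eqP; field.
by move=> /filter_ex[].
Qed.

End Calculus.

(** * Functions near infinity *)

Section Infinity.
Context {R : realType}.
Local Notation E4 := 'rV[R]_4.

(** Neighbourhoods of infinity form a filter, so estimates valid far out combine through filter
    lemmas, and limits at infinity compose with rays and with coordinate changes. *)
Definition einfty : set_system E4 :=
  [set P | exists r : R, forall x, r < enorm x -> P x].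

Global Instance einfty_filter : ProperFilter einfty.
Proof.
apply: Build_ProperFilter_ex.
  move=> P [r rP]; exists ((`|r| + 1) *: delta_mx 0 0); apply: rP.
  apply: lt_le_trans (coord_le_enorm _ 0); rewrite !mxE !eqxx mulr1.
  by rewrite ger0_norm ?addr_ge0// (le_lt_trans (ler_norm r))// ltrDl.
split.
- by exists 0.
- move=> P Q [r rP] [s sQ]; exists (Num.max r s) => x; rewrite gt_max => /andP[rx sx].
  by split; [exact: rP|exact: sQ].
- by move=> P Q PQ [r rP]; exists r => x /rP /PQ.
Qed.

Lemma einfty_gt (r : R) : \forall x \near einfty, r < enorm x.
Proof. by exists r. Qed.

Lemma cvg_ray (x : E4) : x != 0 -> t *: x @[t --> +oo] --> einfty.
Proof.
move=> x0 P [r rP]; have e0 := enorm_gt0 x0.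
apply: filterS2 (nbhs_pinfty_gt (num_real (r / enorm x)))
  (nbhs_pinfty_gt (num_real (0 : R))) => t rt t0.
by apply: rP; rewrite enormZ gtr0_norm// -ltr_pdivrMr.
Qed.
End Infinity.

(** * Integrating decay from infinity in one variable *)

Section OneVariable.
Context {R : realType}.
Implicit Types (f df : R -> R).

Lemma is_derive_invX (c : R) n (s : R) : 0 < s ->
  is_derive s 1 (fun s => c / s ^+ n.+1) (- (c * n.+1%:R) / s ^+ n.+2).
Proof.
move=> s0; pose f (s : R) := s ^+ n.+1.
have sX : f s != 0 by rewrite expf_neq0// gt_eqF.
have dX : derivable f s 1 by exact: exprn_derivable.
have dV : derivable (fun y => (f y)^-1) s 1 by exact: derivableV.
have -> : (fun s => c / s ^+ n.+1) = c *: (fun y => (f y)^-1) by [].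
split; first exact: derivableZ.
rewrite deriveZ// (deriveV sX dX) exp_derive /= /f.
rewrite /GRing.scale /= mulr1 !exprS.
by field; rewrite ?(gt_eqF s0) ?(gt_eqF (exprn_gt0 n s0)).
Qed.

Lemma cvg_invX (K : R) n : K / s ^+ n.+1 @[s --> +oo] --> 0.
Proof.
rewrite -[0](mulr0 K); apply: cvgMr; apply/gtr0_cvgV0.
  by near=> s; rewrite exprn_gt0//; near: s; apply: nbhs_pinfty_gt; exact: num_real.
apply/cvgryPge => A; near=> s.
have s1 : 1 <= s by near: s; apply: nbhs_pinfty_ge; exact: num_real.
have As : A <= s by near: s; apply: nbhs_pinfty_ge; exact: num_real.
by rewrite (le_trans As)// exprS ler_peMr// ?exprn_ege1// (le_trans _ s1).
Unshelve. all: by end_near. Qed.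

(** Comparison replaces integration: adding [B / u ^+ n.+1] to [f] gives a function with derivative
    at most [(B - B * n.+1%:R) / u ^+ n.+2 <= 0], hence non-increasing, and likewise for [- f]. The
    bound gives away a factor [n.+1]. *)
Lemma decay_bound f df n (B s0 : R) : 0 < s0 ->
  (forall s, s0 <= s -> is_derive (s : R) 1 f (df s)) ->
  (forall s, s0 <= s -> `|df s| <= B / s ^+ n.+2) ->
  forall s t, s0 <= s -> s <= t -> `|f s - f t| <= B / s ^+ n.+1.
Proof.
move=> s0_gt0 fd dfB s t s0s st.
have pos u : s0 <= u -> 0 < u by exact: lt_le_trans.
have B0 : 0 <= B.
  have := le_trans (normr_ge0 _) (dfB s s0s).
  by rewrite pmulr_lge0// invr_gt0 exprn_gt0// pos.
have key (g dg : R -> R) : (forall u, s0 <= u -> is_derive u 1 g (dg u)) ->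
    (forall u, s0 <= u -> `|dg u| <= B / u ^+ n.+2) -> g t - g s <= B / s ^+ n.+1.
  move=> gd dgB; pose h (u : R) : R := g u + B / u ^+ n.+1.
  have hd u : s0 <= u -> is_derive u 1 h (dg u + - (B * n.+1%:R) / u ^+ n.+2).
    move=> u0; have := gd u u0; have := is_derive_invX B n (pos u u0).
    by move=> ? ?; apply: is_deriveD.
  have [||c] := MVT_segment st (f := h)
      (df := fun u => dg u + - (B * n.+1%:R) / u ^+ n.+2).
  - by move=> u; rewrite in_itv /= => /andP[su _]; apply: hd; rewrite ltW// (le_lt_trans s0s).
  - apply: derivable_within_continuous => u; rewrite in_itv /= => /andP[su _].
    by have [] := hd u (le_trans s0s su).
  - rewrite in_itv /= => /andP[sc ct] E.
    have c0 := pos c (le_trans s0s sc).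
    have : h t - h s <= 0.
      rewrite E mulr_le0_ge0 ?subr_ge0//.
      rewrite mulNr subr_le0 (le_trans (ler_norm _))// (le_trans (dgB _ (le_trans s0s sc)))//.
      by rewrite ler_pM2r ?invr_gt0 ?exprn_gt0// ler_peMr// ler1n.
    rewrite /h opprD addrACA => H.
    rewrite -subr_le0 (le_trans _ H)// lerD2l lerDr.
    by rewrite divr_ge0// exprn_ge0// ltW// pos// (le_trans s0s).
rewrite ler_norml; apply/andP; split; last first.
  have := @key (- f) (- df) _ _; rewrite !fctE opprK addrC; apply => u su.
    by have := fd u su; move=> ?; apply: is_deriveN.
  by rewrite normrN dfB.
by rewrite lerNl opprB; apply: key fd dfB.
Qed.

(** A form of l'Hopital's rule: [- K / s ^+ n.+1] has derivative [L / s ^+ n.+2], so the difference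
    [g] between [f] and it has derivative at most [e / s ^+ n.+2] far out. The resulting bound on
    [g s - g t] is uniform in [t], and [g t] tends to 0. *)
Lemma decay_limit f df n (L : R) :
  (\forall s \near +oo, is_derive (s : R) 1 f (df s)) ->
  f s @[s --> +oo] --> (0 : R) ->
  s ^+ n.+2 * df s @[s --> +oo] --> L ->
  s ^+ n.+1 * f s @[s --> +oo] --> - (L / n.+1%:R).
Proof.
move=> fd f0 dfL; apply/cvgrPdist_le => e e0.
pose K := L / n.+1%:R.
have invX := cvg_invX K n.
have /cvgrPdist_le /(_ e e0) dfe := dfL.
have [s0 [s0gt0 s0P]] : exists s0 : R, 0 < s0 /\ forall s : R, s0 <= s ->
    is_derive s 1 f (df s) /\ `|L - s ^+ n.+2 * df s| <= e.
  have [M [_ MP]] := filterI fd dfe.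
  exists (`|M| + 1); split; first by rewrite ltr_wpDl.
  by move=> s sM; apply: MP; rewrite (lt_le_trans _ sM)// (le_lt_trans (ler_norm M))// ltrDl.
exists s0; split=> [|s /ltW s0s]; first exact: num_real.
have spos : 0 < s by exact: lt_le_trans s0s.
pose g s := f s + K / s ^+ n.+1.
have g0 : g t @[t --> +oo] --> 0 by rewrite -[0]addr0; exact: cvgD.
have : `|g s - 0| <= e / s ^+ n.+1.
  apply: cvgr_to_le (cvg_norm (cvgB (cvg_cst (g s)) g0)) _.
  near=> t.
  have st : s <= t by near: t; apply: nbhs_pinfty_ge; exact: num_real.
  apply: (@decay_bound g (fun s => df s + - (K * n.+1%:R) / s ^+ n.+2)
    _ _ s0) => //.
  - move=> u s0u; have [? _] := s0P u s0u.
    have := is_derive_invX K n (lt_le_trans s0gt0 s0u).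
    by move=> ?; apply: is_deriveD.
  - move=> u s0u; have [_] := s0P u s0u.
    have u0 : 0 < u ^+ n.+2 by rewrite exprn_gt0// (lt_le_trans s0gt0).
    rewrite (_ : L - _ = - ((df u + - (K * n.+1%:R) / u ^+ n.+2) * u ^+ n.+2)).
      by rewrite normrN normrM (gtr0_norm u0) -ler_pdivlMr.
    rewrite mulrDl divfK ?gt_eqF// /K divfK ?pnatr_eq0// opprD opprK addrC.
    by rewrite [df u * _]mulrC.
have sX : 0 < s ^+ n.+1 by rewrite exprn_gt0.
rewrite subr0 ler_pdivlMr// (_ : - _ - _ = - (g s * s ^+ n.+1)).
  by rewrite normrN normrM (gtr0_norm sX).
by rewrite /g mulrDl divfK ?gt_eqF// opprD addrC [f s * _]mulrC.
Unshelve. all: by end_near. Qed.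
End OneVariable.


(** * Limits at infinity of functions with decaying gradient *)

Section LimitAtInfinity.
Context {R : realType}.
Local Notation E4 := 'rV[R]_4.
Implicit Types (x v : E4) (f : E4 -> R).

Lemma derive_bound f x v (B : R) : differentiable f x ->
  (forall j, `|pd j f x| <= B) -> `|'D_v f x| <= 4 * (enorm v * B).
Proof.
move=> df fB; rewrite derive_pd// (le_trans (ler_norm_sum _ _ _))//.
rewrite (le_trans (ler_sum _ (G := fun=> enorm v * B) _))//.
  by move=> j _; rewrite normrM ler_pM// coord_le_enorm.
by rewrite sumr_const card_ord mulr_natl.
Qed.

Lemma mvt_bound f x v (B : R) :
  (forall s, 0 <= s <= 1 -> differentiable f (x + s *: v)) ->
  (forall s j, 0 <= s <= 1 -> `|pd j f (x + s *: v)| <= B) ->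
  `|f (x + v) - f x| <= 4 * (enorm v * B).
Proof.
move=> df fB; have [s s01 ->] := mvt_line df.
by rewrite -derive_pd; [apply: derive_bound => [|j]; [exact: df|exact: fB]|exact: df].
Qed.

Lemma is_derive_ray f x (s : R) : differentiable f (s *: x) ->
  is_derive s 1 (fun s => f (s *: x)) ('D_x f (s *: x)).
Proof.
move=> df; have := @is_derive_line _ f 0 x s; rewrite add0r.
by under eq_fun do rewrite add0r; exact.
Qed.

(** Since the cross term is non-negative, [|(1 - s) x + s y|^2 >= ((1 - s)^2 + s^2) r^2 >= r^2 / 2];
    the weaker bound [r / 2] avoids a square root. *)
Lemma segment_enorm x y (r s : R) : 0 <= r -> r <= enorm x -> r <= enorm y ->
  0 <= dotp x y -> 0 <= s <= 1 -> r / 2 <= enorm (x + s *: (y - x)).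
Proof.
move=> r0 rx ry xy /andP[s0 s1].
rewrite -(@ler_pXn2r _ 2)// ?nnegrE ?enorm_ge0 ?divr_ge0//.
have rx2 : r ^+ 2 <= enorm x ^+ 2 by rewrite lerXn2r ?nnegrE ?enorm_ge0.
have ry2 : r ^+ 2 <= enorm y ^+ 2 by rewrite lerXn2r ?nnegrE ?enorm_ge0.
rewrite enorm_sqr.
have -> : dotp (x + s *: (y - x)) (x + s *: (y - x)) =
    (1 - s) ^+ 2 * enorm x ^+ 2 + 2 * s * (1 - s) * dotp x y + s ^+ 2 * enorm y ^+ 2.
  rewrite !enorm_sqr /dotp !mulr_sumr -!big_split /=; apply: eq_bigr => i _.
  rewrite !mxE; ring.
have H1 : (1 - s) ^+ 2 * r ^+ 2 <= (1 - s) ^+ 2 * enorm x ^+ 2.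
  by rewrite ler_wpM2l// sqr_ge0.
have H2 : s ^+ 2 * r ^+ 2 <= s ^+ 2 * enorm y ^+ 2 by rewrite ler_wpM2l// sqr_ge0.
have H3 : 0 <= 2 * s * (1 - s) * dotp x y by rewrite !mulr_ge0// subr_ge0.
have H4 : 0 <= (2 * s - 1) ^+ 2 * r ^+ 2 by rewrite mulr_ge0 ?sqr_ge0.
have H5 : 0 <= r ^+ 2 by exact: sqr_ge0.
move: H1 H2 H3 H4 H5; rewrite exprMn.
move: (enorm x ^+ 2) (enorm y ^+ 2) (dotp x y) (r ^+ 2) => X Y D P.
move: (_ * X) (_ * Y) (_ * D) => X' Y' D'.
by rewrite !expr2; nra.
Qed.

(* f has a limit along every ray.  Rays at an angle of at most pi/2 have the same
   limit, because the segment joining their points at time t stays at distance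
   of order t from the origin; any two directions are linked through e_0, e_1
   and - e_0 by such steps. *)
Lemma cvg_einfty_pd f n (C : R) :
  (\forall x \near einfty, differentiable f x) ->
  (\forall x \near einfty, forall j, `|pd j f x| <= C / enorm x ^+ n.+2) ->
  exists c K : R, \forall x \near einfty, `|f x - c| <= K / enorm x ^+ n.+1.
Proof.
move=> df fC; have [r0 r0P] := filterI df fC.
pose r := `|r0| + 1.
have r_gt0 : 0 < r by rewrite ltr_wpDl.
have {r0P} rP x : r <= enorm x ->
    differentiable f x /\ forall j, `|pd j f x| <= C / enorm x ^+ n.+2.
  by move=> rx; apply: r0P; rewrite (lt_le_trans _ rx)// (le_lt_trans (ler_norm r0))// ltrDl.
have C0 : 0 <= C.
  have [x [rx]] : exists x : E4, r < enorm x.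
    by have [x] := filter_ex (einfty_gt r); exists x.
  have [_ /(_ 0)] := rP _ (ltW rx).
  move=> /(le_trans (normr_ge0 _)); rewrite pmulr_lge0// invr_gt0 exprn_gt0//.
  exact: lt_trans rx.
(* The derivative along the ray at parameter [s] is at most [4 * (enorm x * (C / enorm (s *: x) ^+
   n.+2))], which is [B x / s ^+ n.+2]. *)
pose B x := 4 * C / enorm x ^+ n.+1.
have ray x : r <= enorm x -> forall s t : R, 1 <= s -> s <= t ->
    `|f (s *: x) - f (t *: x)| <= B x / s ^+ n.+1.
  move=> rx; have x0 : 0 < enorm x by exact: lt_le_trans rx.
  have sx s : 1 <= s -> r <= enorm (s *: x).
    move=> s1; rewrite enormZ ger0_norm ?(le_trans _ s1)// (le_trans rx)//.
    by rewrite ler_peMl// ltW.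
  apply: (decay_bound (f := fun s => f (s *: x)) (df := fun s => 'D_x f (s *: x)) ltr01).
    by move=> s s1; apply: is_derive_ray; have [] := rP _ (sx _ s1).
  move=> s s1; have [dfs pfs] := rP _ (sx _ s1).
  rewrite (le_trans (@derive_bound _ _ _ _ dfs pfs))// enormZ ger0_norm ?(le_trans _ s1)//.
  have s0 : 0 < s by exact: lt_le_trans s1.
  rewrite le_eqVlt; apply/orP; left; apply/eqP.
  rewrite /B exprMn !exprS; field.
  by rewrite ?(gt_eqF s0) ?(gt_eqF x0) ?(gt_eqF (exprn_gt0 n s0)) ?(gt_eqF (exprn_gt0 n x0)).
have cv x : r <= enorm x -> cvg (f (t *: x) @[t --> +oo]).
  move=> rx; apply: cauchy_cvg; apply: cauchy_exP => e e0.
  have /cvgrPdist_lt /(_ e e0) := cvg_invX (B x) n.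
  move=> /(filterI (nbhs_pinfty_ge (num_real (1 : R)))) /filter_ex [s [s1 sB]].
  exists (f (s *: x)).
  suff : \forall t \near +oo, ball (f (s *: x)) e (f (t *: x)) by [].
  near=> t.
  have st : s <= t by near: t; apply: nbhs_pinfty_ge; exact: num_real.
  rewrite /ball /= (le_lt_trans (ray _ rx _ _ s1 st))//.
  by move: sB; rewrite sub0r normrN; apply: le_lt_trans; exact: ler_norm.
pose c x := lim (f (t *: x) @[t --> +oo]).
have cB x : r <= enorm x -> `|f x - c x| <= B x.
  move=> rx; have := cv x rx => /(cvgB (cvg_cst (f x))) /cvg_norm.
  move=> /cvgr_to_le; apply; near=> t.
  have t1 : 1 <= t by near: t; apply: nbhs_pinfty_ge; exact: num_real.
  by have := ray x rx 1 t (lexx 1) t1; rewrite scale1r expr1n divr1.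
have c_eq x y : r <= enorm x -> r <= enorm y -> 0 <= dotp x y -> c x = c y.
  move=> rx ry xy; apply/eqP; rewrite eq_sym -subr_eq0 -normr_le0.
  (* At time [t] the chord has length [t * enorm (y - x)] and the gradient on it is O(t^(-n-2)), so
     the values at its ends differ by at most [D / t ^+ n.+1]. *)
  pose D := 4 * (enorm (y - x) * (C / (r / 2) ^+ n.+2)).
  apply: ler_cvg_to (cvg_norm (cvgB (cv _ ry) (cv _ rx))) (cvg_invX D n) _.
  near=> t.
  (* From [t = 2] on, the distance [t * (r / 2)] of the chord from the origin is at least [r], where
     the hypotheses hold. *)
  have t2 : 2 <= t by near: t; apply: nbhs_pinfty_ge; exact: num_real.
  have t0 : 0 < t by exact: lt_le_trans t2.
  have seg s : 0 <= s <= 1 -> t * (r / 2) <= enorm (t *: x + s *: (t *: y - t *: x)).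
    move=> s01; rewrite -scalerBr scalerA [s * t]mulrC -scalerA -scalerDr enormZ gtr0_norm//.
    by rewrite ler_pM2l// segment_enorm// ltW.
  have segr s : 0 <= s <= 1 -> r <= enorm (t *: x + s *: (t *: y - t *: x)).
    move=> /seg; apply: le_trans; rewrite mulrCA ler_pMr// ler_pdivlMr// mul1r//.
  have := @mvt_bound f (t *: x) (t *: y - t *: x) (C / (t * (r / 2)) ^+ n.+2).
  have -> : t *: x + (t *: y - t *: x) = t *: y by rewrite addrC subrK.
  move=> H; rewrite (le_trans (H _ _))//.
  - by move=> s /segr /rP[].
  - move=> s j s01; have [_ /(_ j) /le_trans] := rP _ (segr _ s01); apply.
    have p0 : 0 < t * (r / 2) by rewrite mulr_gt0 ?divr_gt0.
    have q := seg s s01; have q0 := lt_le_trans p0 q.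
    rewrite ler_wpM2l// lef_pV2 ?posrE ?exprn_gt0//.
    by rewrite lerXn2r ?nnegrE ?(ltW p0) ?(ltW q0).
  - rewrite -scalerBr enormZ gtr0_norm// le_eqVlt; apply/orP; left; apply/eqP.
    rewrite /D !exprMn [t ^+ n.+2]exprS; field.
    by rewrite !expf_neq0 ?gt_eqF// invr_gt0.
pose u (i : 'I_4) : E4 := r *: delta_mx 0 i.
have ur i : enorm (u i) = r.
  rewrite enormZ gtr0_norm// /enorm (bigD1 i)//= big1 ?addr0.
    by rewrite mxE !eqxx expr1n sqrtr1 mulr1.
  by move=> j ji; rewrite mxE (negbTE ji) andbF expr0n.
have urN i : enorm (- u i) = r by rewrite -scaleN1r enormZ normrN1 mul1r ur.
have du i x : dotp x (u i) = r * x 0 i.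
  rewrite /dotp (bigD1 i)//= big1 ?addr0; first by rewrite !mxE !eqxx mulr1 mulrC.
  by move=> j ji; rewrite !mxE (negbTE ji) andbF !mulr0.
have duN i x : dotp x (- u i) = - (r * x 0 i).
  by rewrite -du /dotp -sumrN; apply: eq_bigr => j _; rewrite mxE mulrN.
have cu x : r <= enorm x -> c x = c (u 0).
  move=> rx; have [x0|x0] := lerP 0 (x 0 0).
    by apply: c_eq; rewrite ?ur ?du ?mulr_ge0// ltW.
  transitivity (c (- u 0)).
    by apply: c_eq; rewrite ?urN ?duN// oppr_ge0 pmulr_rle0// ltW.
  transitivity (c (u 1)).
    by apply: c_eq; rewrite ?ur ?urN ?du// !mxE /= !mulr0 oppr0 mulr0.
  by apply: c_eq; rewrite ?ur ?urN ?du// !mxE /= !mulr0.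
exists (c (u 0)), (4 * C); exists r => x rx.
by rewrite -(cu _ (ltW rx)) cB// ltW.
Unshelve. all: by end_near. Qed.

End LimitAtInfinity.


(** * The leading term of the metric *)

Section DerivativeRules.
Context {R : realType}.
Local Notation E4 := 'rV[R]_4.
Implicit Types (x v : E4) (f g : E4 -> R).

Lemma is_derive_sumf x v n (h : 'I_n -> E4 -> R) (dh : 'I_n -> R) :
  (forall i, is_derive x v (h i) (dh i)) ->
  is_derive x v (fun z => \sum_i h i z) (\sum_i dh i).
Proof.
move=> hd; rewrite (_ : (fun z => _) = \sum_i h i); first exact: is_derive_sum.
by apply/funext => z; rewrite fct_sumE.
Qed.

Lemma is_derive_mulf x v f g (df dg : R) : is_derive x v f df ->
  is_derive x v g dg -> is_derive x v (fun z => f z * g z) (f x * dg + g x * df).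
Proof. by move=> ? ?; exact: is_deriveM. Qed.

Lemma is_derive_invf x v f (df : R) : f x != 0 -> is_derive x v f df ->
  is_derive x v (fun z => (f z)^-1) (- df / f x ^+ 2).
Proof.
move=> fx0 [dfx <-]; split; first exact: derivableV.
by rewrite deriveV// /GRing.scale /= mulNr mulrC mulNr.
Qed.

Lemma is_derive_coord x v k : is_derive x v (fun z : E4 => z 0 k) (v 0 k).
Proof.
have E : \forall h \near 0^', h^-1 *: (((fun z : E4 => z 0 k) \o shift x) (h *: v) - x 0 k)
    = v 0 k.
  near=> h; have h0 : h != 0 by near: h; exact: nbhs_dnbhs_neq.
  by rewrite /= !mxE addrK /GRing.scale /= mulKf.
by split; [exact: is_cvg_near_cst E|exact: lim_near_cst E].
Unshelve. all: by end_near. Qed.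

Lemma pd_val x f i (df : R) : is_derive x (delta_mx 0 i) f df -> pd i f x = df.
Proof. by case. Qed.

Lemma differentiable_sumf x n (h : 'I_n -> E4 -> R) :
  (forall i, differentiable (h i) x) ->
  differentiable (fun z => \sum_i h i z) x.
Proof.
move=> hd; rewrite (_ : (fun z => _) = \sum_i h i); first exact: differentiable_sum.
by apply/funext => z; rewrite fct_sumE.
Qed.

Lemma differentiable_mulf x f g : differentiable f x -> differentiable g x ->
  differentiable (fun z => f z * g z) x.
Proof. exact: differentiableM. Qed.

End DerivativeRules.

(** * Quadratic forms divided by the fourth power of the radius *)

Section Quadratic.
Context {R : realType}.
Local Notation E4 := 'rV[R]_4.
Implicit Types (x v : E4) (c : 'I_4 -> 'I_4 -> R).

Definition quad c x : R := \sum_k \sum_l c k l * (x 0 k * x 0 l).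
(** [dquad c m] and [dhquad c m] will be the [m]-th partial derivatives of [quad c] and [hquad c].
    The coefficients are not assumed symmetric: [W i k l j] need not be symmetric in [k] and [l]. *)
Definition dquad c m x : R := \sum_l (c m l + c l m) * x 0 l.
Definition hquad c x : R := quad c x / dotp x x ^+ 2.
Definition dhquad c m x : R :=
  dquad c m x / dotp x x ^+ 2 - 4 * quad c x * x 0 m / dotp x x ^+ 3.

Lemma sum_deltar n (i : 'I_n) (f : 'I_n -> R) : \sum_k (i == k)%:R * f k = f i.
Proof.
rewrite (bigD1 i)//= eqxx mul1r big1 ?addr0// => k ki.
by rewrite eq_sym (negbTE ki) mul0r.
Qed.

Lemma dotp_gt0 x : x != 0 -> 0 < dotp x x.
Proof. by move=> x0; rewrite -enorm_sqr exprn_gt0// enorm_gt0. Qed.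

Lemma dotpZ x (t : R) : dotp (t *: x) (t *: x) = t ^+ 2 * dotp x x.
Proof.
rewrite /dotp mulr_sumr; apply: eq_bigr => i _; rewrite !mxE; ring.
Qed.

Lemma hquadE c x : hquad c x = \sum_k \sum_l c k l * (x 0 k * x 0 l / enorm x ^+ 4).
Proof.
rewrite /hquad /quad mulr_suml; apply: eq_bigr => k _.
rewrite mulr_suml; apply: eq_bigr => l _.
by rewrite -mulrA -enorm_sqr -exprM.
Qed.

Lemma quadZ c x (t : R) : quad c (t *: x) = t ^+ 2 * quad c x.
Proof.
rewrite /quad mulr_sumr; apply: eq_bigr => k _.
rewrite mulr_sumr; apply: eq_bigr => l _; rewrite !mxE; ring.
Qed.

Lemma dquadZ c m x (t : R) : dquad c m (t *: x) = t * dquad c m x.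
Proof.
rewrite /dquad mulr_sumr; apply: eq_bigr => k _; rewrite !mxE; ring.
Qed.

Lemma dhquadZ c m x (t : R) : t != 0 -> x != 0 ->
  dhquad c m (t *: x) = dhquad c m x / t ^+ 3.
Proof.
move=> t0 x0; rewrite /dhquad quadZ dquadZ dotpZ !mxE; have := dotp_gt0 x0.
by move=> /lt0r_neq0 N0; field; rewrite N0 t0.
Qed.

Lemma dquad_euler c x : \sum_m x 0 m * dquad c m x = 2 * quad c x.
Proof.
have E : \sum_m \sum_l c l m * (x 0 l * x 0 m) = quad c x by rewrite exchange_big.
rewrite mulr_natl mulr2n -{2}E -big_split /=; apply: eq_bigr => m _.
by rewrite /dquad mulr_sumr -big_split /=; apply: eq_bigr => l _; ring.
Qed.

(** Euler's identity: [hquad c] is homogeneous of degree -2. *)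
Lemma dhquad_euler c x : x != 0 -> \sum_m x 0 m * dhquad c m x = - 2 * hquad c x.
Proof.
move=> x0; have /lt0r_neq0 N0 := dotp_gt0 x0.
transitivity ((\sum_m x 0 m * dquad c m x) / dotp x x ^+ 2
    - 4 * quad c x * dotp x x / dotp x x ^+ 3).
  rewrite {2}/dotp mulr_suml mulr_sumr mulr_suml -sumrB; apply: eq_bigr => m _.
  by rewrite /dhquad; field.
by rewrite dquad_euler /hquad; field.
Qed.

Lemma is_derive_quad c m x : is_derive x (delta_mx 0 m) (quad c) (dquad c m x).
Proof.
have d k l := is_derive_mulf (is_derive_coord x (delta_mx 0 m) k)
   (is_derive_coord x (delta_mx 0 m) l).
have H := is_derive_sumf (fun k => is_derive_sumf (fun l =>
   is_derive_mulf (is_derive_cst (c k l) x (delta_mx 0 m)) (d k l))).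
refine (is_derive_eq H _).
transitivity (\sum_k (\sum_l (m == l)%:R * (c k l * x 0 k) +
    (m == k)%:R * (\sum_l c k l * x 0 l))).
  apply: eq_bigr => k _; rewrite mulr_sumr -big_split; apply: eq_bigr => l _.
  by rewrite !mxE !eqxx /= ![_ == m]eq_sym /cst; ring.
rewrite big_split /= sum_deltar /dquad.
under eq_bigr do rewrite sum_deltar.
by rewrite addrC -big_split; apply: eq_bigr => k _; rewrite mulrDl.
Qed.

Lemma is_derive_dotp m x :
  is_derive x (delta_mx 0 m) (fun z => dotp z z) (2 * x 0 m).
Proof.
have -> : (fun z => dotp z z) = quad (fun k l => (k == l)%:R).
  by apply/funext => z; apply: eq_bigr => k _; rewrite sum_deltar.
refine (is_derive_eq (is_derive_quad _ _ _) _).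
rewrite /dquad; under eq_bigr => l _ do rewrite [l == m]eq_sym mulrDl.
by rewrite big_split /= !sum_deltar; ring.
Qed.

Lemma is_derive_hquad c m x : x != 0 ->
  is_derive x (delta_mx 0 m) (hquad c) (dhquad c m x).
Proof.
move=> x0; have /lt0r_neq0 N0 := dotp_gt0 x0.
have dN := is_derive_dotp m x.
have dN2 := is_derive_mulf dN dN.
have NN : dotp x x * dotp x x != 0 by rewrite mulf_neq0.
have H := is_derive_mulf (is_derive_quad c m x) (is_derive_invf NN dN2).
by refine (is_derive_eq H _); rewrite /dhquad; field.
Qed.

Lemma differentiable_quad c x : differentiable (quad c) x.
Proof.
apply: differentiable_sumf => k; apply: differentiable_sumf => l.
by do 2 apply: differentiable_mulf => //; exact: differentiable_coord.
Qed.

Lemma differentiable_dotpVn n x : x != 0 ->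
  differentiable (fun z => (dotp z z ^+ n)^-1) x.
Proof.
move=> /dotp_gt0 /lt0r_neq0 N0; apply: differentiableV; last by rewrite expf_neq0.
elim: n => [|n IHn]; first by under eq_fun do rewrite expr0.
under eq_fun do rewrite exprS.
apply: differentiable_mulf => //.
by apply: differentiable_sumf => k; apply: differentiable_mulf; exact: differentiable_coord.
Qed.

Lemma differentiable_dhquad c m x : x != 0 -> differentiable (dhquad c m) x.
Proof.
move=> x0; apply: differentiableB; apply: differentiable_mulf;
  try exact: differentiable_dotpVn.
  apply: differentiable_sumf => l.
  by apply: differentiable_mulf => //; exact: differentiable_coord.
apply: differentiable_mulf; last exact: differentiable_coord.
by apply: differentiable_mulf => //; exact: differentiable_quad.
Qed.

Definition sumabs c : R := \sum_k \sum_l `|c k l|.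

Lemma quad_bound c x : `|quad c x| <= sumabs c * enorm x ^+ 2.
Proof.
rewrite /sumabs mulr_suml (le_trans (ler_norm_sum _ _ _))//; apply: ler_sum => k _.
rewrite mulr_suml (le_trans (ler_norm_sum _ _ _))//; apply: ler_sum => l _.
by rewrite normrM ler_wpM2l// normrM expr2 ler_pM// coord_le_enorm.
Qed.

Lemma dquad_bound c m x : `|dquad c m x| <= 2 * sumabs c * enorm x.
Proof.
have A : \sum_l `|c m l| <= sumabs c.
  rewrite /sumabs [leRHS](bigD1 m)//= lerDl; apply: sumr_ge0 => k _.
  by apply: sumr_ge0.
have B : \sum_l `|c l m| <= sumabs c.
  rewrite [leRHS]exchange_big [leRHS](bigD1 m)//= lerDl; apply: sumr_ge0 => k _.
  by apply: sumr_ge0.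
have e0 := enorm_ge0 x.
apply: (@le_trans _ _ ((\sum_l `|c m l| + \sum_l `|c l m|) * enorm x)).
  rewrite -big_split mulr_suml (le_trans (ler_norm_sum _ _ _))//; apply: ler_sum => l _.
  by rewrite normrM ler_pM// ?coord_le_enorm// ler_normD.
by rewrite ler_wpM2r// mulr_natl mulr2n lerD.
Qed.

Lemma hquad_bound c x : x != 0 -> `|hquad c x| <= sumabs c / enorm x ^+ 2.
Proof.
move=> x0; have e0 := enorm_gt0 x0.
rewrite /hquad -enorm_sqr -exprM normrM normfV [X in _ / X]ger0_norm ?exprn_ge0 ?(ltW e0)//.
rewrite ler_pdivrMr ?exprn_gt0// (le_trans (quad_bound _ _))//.
rewrite le_eqVlt; apply/orP; left; apply/eqP; field; exact: lt0r_neq0.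
Qed.

Lemma dhquad_bound c m x : x != 0 -> `|dhquad c m x| <= 6 * sumabs c / enorm x ^+ 3.
Proof.
move=> x0; have e0 := enorm_gt0 x0.
rewrite /dhquad -enorm_sqr -!exprM (le_trans (ler_normB _ _))//.
rewrite [leRHS](_ : _ = 2 * sumabs c / enorm x ^+ 3 + 4 * sumabs c / enorm x ^+ 3); last first.
  by rewrite -mulrDl -mulrDl -natrD.
apply: lerD.
  rewrite normrM normfV [X in _ / X]ger0_norm ?exprn_ge0 ?(ltW e0)//.
  rewrite ler_pdivrMr ?exprn_gt0// (le_trans (dquad_bound _ _ _))//.
  rewrite le_eqVlt; apply/orP; left; apply/eqP; field; exact: lt0r_neq0.
rewrite normrM normfV [X in _ / X]ger0_norm ?exprn_ge0 ?(ltW e0)//.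
rewrite ler_pdivrMr ?exprn_gt0// -mulrA normrM ger0_norm// -2!mulrA ler_pM2l//.
rewrite normrM (le_trans (ler_pM _ _ (quad_bound _ _) (coord_le_enorm _ _)))//.
rewrite le_eqVlt; apply/orP; left; apply/eqP; field; exact: lt0r_neq0.
Qed.

End Quadratic.


(** * The model coefficient and rotations of curvature tensors *)

Section Model.
Context {R : realType}.
Local Notation E4 := 'rV[R]_4.
Local Notation tensor4 := ('I_4 -> 'I_4 -> 'I_4 -> 'I_4 -> R).
Implicit Types (x : E4) (lam : R) (W : tensor4).

Definition mcoef lam W (i j k l : 'I_4) : R := Xi lam i j k l + W i k l j.

(** Separates the part built from [|x|^2] and [x_i x_j] from the Jacobi operator [W(., x, x, .)];
    the two symmetric terms of [Xi] merge into the coefficient [4 * lam / 9]. *)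
Lemma quad_mcoef lam W i j x : quad (mcoef lam W i j) x =
  - (lam / 9) * (i == j)%:R * dotp x x + 4 * lam / 9 * (x 0 i * x 0 j)
  + quad (fun k l => W i k l j) x.
Proof.
transitivity (\sum_k (- (lam / 9) * (i == j)%:R * (x 0 k * x 0 k)
    + 2 * lam / 9 * ((i == k)%:R * (x 0 k * x 0 j))
    + 2 * lam / 9 * ((j == k)%:R * (x 0 k * x 0 i))
    + \sum_l W i k l j * (x 0 k * x 0 l))); last first.
  by rewrite !big_split /= -!mulr_sumr !sum_deltar /dotp /quad; field.
rewrite /quad; apply: eq_bigr => k _.
rewrite -[x 0 k * x 0 k in RHS](sum_deltar k (fun l => x 0 k * x 0 l)).
rewrite -[x 0 k * x 0 j in RHS](sum_deltar j (fun l => x 0 k * x 0 l)).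
rewrite -[x 0 k * x 0 i in RHS](sum_deltar i (fun l => x 0 k * x 0 l)).
rewrite !mulr_sumr -!big_split /=; apply: eq_bigr => l _.
rewrite /mcoef /Xi; ring.
Qed.

Lemma quad_swap (c : 'I_4 -> 'I_4 -> R) x : quad (fun k l => c l k) x = quad c x.
Proof.
rewrite /quad exchange_big; apply: eq_bigr => k _; apply: eq_bigr => l _.
by rewrite [x 0 l * _]mulrC.
Qed.

Lemma quad_anti (c : 'I_4 -> 'I_4 -> R) x :
  (forall k l, c l k = - c k l) -> quad c x = 0.
Proof.
move=> cN; apply/eqP; rewrite -[_ == 0](mulrn_eq0 _ 2) mulr2n -{1}quad_swap addrC.
rewrite /quad -big_split big1//= => k _; rewrite -big_split big1//= => l _.
by rewrite [c l k]cN mulNr ?subrr ?addNr.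
Qed.

(** Pair symmetry and two changes of sign turn [W i l k j] into [W j k l i], and the quadratic form
    does not see the exchange of [k] and [l]. *)
Lemma quad_mcoef_sym lam W i j x : algebraic_weyl W ->
  quad (mcoef lam W i j) x = quad (mcoef lam W j i) x.
Proof.
move=> HW; rewrite !quad_mcoef eq_sym [x 0 i * _]mulrC; congr (_ + _).
rewrite -quad_swap; apply: eq_bigr => k _; apply: eq_bigr => l _; congr (_ * _).
by rewrite -(weyl_pair HW) (weyl_anti12 HW) (weyl_anti34 HW) opprK.
Qed.

(** The Weyl term dies because [W] is antisymmetric in its last two indices, both contracted with
    [x]. What is left is [- lam / 9 + 4 * lam / 9 = lam / 3]. *)
Lemma quad_mcoef_contract lam W i x : algebraic_weyl W ->
  \sum_j x 0 j * quad (mcoef lam W i j) x = lam / 3 * x 0 i * dotp x x.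
Proof.
move=> HW; under eq_bigr do rewrite quad_mcoef mulrDr.
rewrite big_split /= [X in _ + X](_ : _ = 0) ?addr0.
  under eq_bigr => j _ do rewrite mulrDr.
  rewrite big_split /=.
  rewrite [X in X + _](_ : _ = - (lam / 9) * dotp x x * \sum_j (i == j)%:R * x 0 j).
    rewrite [X in _ + X](_ : _ = 4 * lam / 9 * x 0 i * dotp x x).
      by rewrite sum_deltar; field.
    by rewrite /dotp mulr_sumr; apply: eq_bigr => j _; ring.
  by rewrite mulr_sumr; apply: eq_bigr => j _; ring.
rewrite /quad; under eq_bigr do rewrite mulr_sumr.
rewrite exchange_big /= big1// => k _.
under eq_bigr do rewrite mulr_sumr.
transitivity (x 0 k * quad (fun j l => W i k l j) x); last first.
  by rewrite quad_anti ?mulr0// => j l; rewrite (weyl_anti34 HW).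
rewrite /quad mulr_sumr; apply: eq_bigr => j _.
by rewrite mulr_sumr; apply: eq_bigr => l _; ring.
Qed.

Lemma hquad_mcoef_sym lam W i j x : algebraic_weyl W ->
  hquad (mcoef lam W i j) x = hquad (mcoef lam W j i) x.
Proof. by move=> HW; rewrite /hquad quad_mcoef_sym. Qed.

Lemma hquad_mcoef_contract lam W i x : algebraic_weyl W ->
  \sum_j x 0 j * hquad (mcoef lam W i j) x = lam / 3 * x 0 i / dotp x x.
Proof.
move=> HW; rewrite /hquad; under eq_bigr do rewrite mulrA.
rewrite -mulr_suml quad_mcoef_contract//.
have [->|x0] := eqVneq x 0; first by rewrite mxE !mulr0 !mul0r.
by have /lt0r_neq0 N0 := dotp_gt0 x0; field.
Qed.

(* Differentiate the radial contraction x_i h_ik = (lam/3) x_k / |x|^2: apart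
   from - h_jk all terms are symmetric in j and k. *)
Lemma dhquad_mcoef_contract lam W j k x : algebraic_weyl W -> x != 0 ->
  \sum_i x 0 i * dhquad (mcoef lam W i k) j x =
  \sum_i x 0 i * dhquad (mcoef lam W i j) k x.
Proof.
move=> HW x0; have /lt0r_neq0 N0 := dotp_gt0 x0.
have E a b : \sum_i x 0 i * dhquad (mcoef lam W i b) a x =
    lam / 3 * ((a == b)%:R / dotp x x - 2 * x 0 a * x 0 b / dotp x x ^+ 2)
    - hquad (mcoef lam W a b) x.
  have dl := is_derive_sumf (fun i => is_derive_mulf
    (is_derive_coord x (delta_mx 0 a) i) (is_derive_hquad (mcoef lam W i b) a x0)).
  have dr := is_derive_mulf (is_derive_mulf (is_derive_cst (lam / 3) x (delta_mx 0 a))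
    (is_derive_coord x (delta_mx 0 a) b))
    (is_derive_invf (f := fun z => dotp z z) N0
    (is_derive_dotp a x)).
  have Ef : (fun z : E4 => \sum_i z 0 i * hquad (mcoef lam W i b) z) =
      (fun z => cst (lam / 3) z * z 0 b * (dotp z z)^-1).
    apply/funext => z; under eq_bigr do rewrite hquad_mcoef_sym//.
    exact: hquad_mcoef_contract.
  have := pd_val dl; rewrite Ef.
  have T : \sum_i hquad (mcoef lam W i b) x * (delta_mx 0 a : E4) 0 i =
      hquad (mcoef lam W a b) x.
    under eq_bigr => i _ do rewrite !mxE eqxx /= mulrC [i == a]eq_sym.
    by rewrite sum_deltar.
  rewrite (pd_val dr) big_split /= T => /(canLR (addrK _)) <-.
  by rewrite !mxE eqxx /= [b == a]eq_sym /cst; congr (_ - _); field.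
rewrite !E hquad_mcoef_sym// [j == k]eq_sym; congr (_ * (_ - _ / _) - _); ring.
Qed.

(** Polarization by differentiation: the gradient of the zero form, evaluated at a basis vector, is
    the symmetrized coefficient. *)
Lemma quad_polar (c : 'I_4 -> 'I_4 -> R) k l : (forall x, quad c x = 0) ->
  c k l + c l k = 0.
Proof.
move=> c0.
have qd (m : 'I_4) x : dquad c m x = 0.
  rewrite -(pd_val (is_derive_quad c m x)) (_ : quad c = cst 0); last exact/funext.
  by rewrite /pd derive_cst.
have := qd k (delta_mx 0 l); rewrite /dquad.
under eq_bigr => i _ do rewrite mxE eqxx /= mulrC [i == l]eq_sym.
by rewrite sum_deltar.
Qed.

(** These identities are preserved by differences and by [rotate A] for any matrix [A], so they pass
    to the difference of one Weyl tensor and the rotation of the other. *)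
Record curvature_like (W : tensor4) : Prop := CurvatureLike {
  curv_anti12 : forall i j k l, W j i k l = - W i j k l;
  curv_anti34 : forall i j k l, W i j l k = - W i j k l;
  curv_pair : forall i j k l, W k l i j = W i j k l;
  curv_bianchi : forall i j k l, W i j k l + W j k i l + W k i j l = 0 }.

(* The Jacobi operators W(., x, x, .) determine an algebraic curvature tensor. *)
Lemma curvature_like0 W : curvature_like W ->
  (forall i j x, quad (fun k l => W i k l j) x = 0) ->
  forall i j k l, W i j k l = 0.
Proof.
move=> [a12 a34 pr bi] q0 i j k l.
(* Polarization gives antisymmetry in the middle pair; together with the outer two, [W] changes sign
   under every transposition of neighbours, and the Bianchi identity reads [3 * W i j k l = 0]. *)
have mid i' j' k' l' : W i' j' k' l' = - W i' k' j' l'.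
  by apply/eqP; rewrite -addr_eq0; apply/eqP; exact: (quad_polar _ _ (q0 i' l')).
have := bi i j k l; rewrite [W j k i l]mid [W j i k l]a12 opprK.
rewrite [W k i j l]a12 [W i k j l]mid opprK.
by move=> E; apply/eqP; rewrite -[_ == 0](mulrn_eq0 _ 3) mulrS mulr2n addrA E.
Qed.

(** The pullback of [W] under the linear map sending [x] to [x *m A], whose Jacobian is [A] in the
    row-vector convention. *)
Definition rotate (A : 'M[R]_4) W : tensor4 := fun i j k l =>
  \sum_a \sum_b \sum_c \sum_d A i a * A j b * A k c * A l d * W a b c d.

Lemma exchange_big2 (f : 'I_4 -> 'I_4 -> 'I_4 -> R) :
  \sum_k \sum_l \sum_a f k l a = \sum_a \sum_k \sum_l f k l a.
Proof.
transitivity (\sum_k \sum_a \sum_l f k l a); last by rewrite exchange_big.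
by apply: eq_bigr => k _; rewrite exchange_big.
Qed.

Lemma quad_rotate (A : 'M[R]_4) W i j x :
  quad (fun k l => rotate A W i k l j) x =
  \sum_a \sum_b A i a * A j b * quad (fun p q => W a p q b) (x *m A).
Proof.
transitivity (\sum_k \sum_l \sum_a \sum_p \sum_q \sum_b
   A i a * A k p * A l q * A j b * W a p q b * (x 0 k * x 0 l)).
  apply: eq_bigr => k _; apply: eq_bigr => l _.
  rewrite /rotate mulr_suml; apply: eq_bigr => a _.
  rewrite mulr_suml; apply: eq_bigr => p _.
  rewrite mulr_suml; apply: eq_bigr => q _.
  by rewrite mulr_suml.
rewrite exchange_big2; apply: eq_bigr => a _.
transitivity (\sum_p \sum_q \sum_b \sum_k \sum_l
   A i a * A k p * A l q * A j b * W a p q b * (x 0 k * x 0 l)).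
  rewrite exchange_big2; apply: eq_bigr => p _.
  rewrite exchange_big2; apply: eq_bigr => q _.
  by rewrite exchange_big2.
rewrite exchange_big2; apply: eq_bigr => b _.
rewrite /quad mulr_sumr; apply: eq_bigr => p _.
rewrite mulr_sumr; apply: eq_bigr => q _.
rewrite !mxE mulr_suml !mulr_sumr; apply: eq_bigr => k _.
rewrite !mulr_sumr; apply: eq_bigr => l _; ring.
Qed.

Lemma curvature_like_weyl W : algebraic_weyl W -> curvature_like W.
Proof. by case. Qed.

Lemma curvature_like_sub W1 W2 : curvature_like W1 -> curvature_like W2 ->
  curvature_like (fun i j k l => W1 i j k l - W2 i j k l).
Proof.
move=> [a b c d] [a' b' c' d']; split => i j k l.
- by rewrite a a' opprB opprK addrC.
- by rewrite b b' opprB opprK addrC.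
- by rewrite c c'.
- transitivity ((W1 i j k l + W1 j k i l + W1 k i j l)
    - (W2 i j k l + W2 j k i l + W2 k i j l)); first by ring.
  by rewrite d d' subrr.
Qed.

Lemma curvature_like_rotate (A : 'M[R]_4) W : curvature_like W ->
  curvature_like (rotate A W).
Proof.
move=> [a12 a34 pr bi]; split => i j k l; rewrite /rotate.
- rewrite exchange_big -sumrN; apply: eq_bigr => a _; rewrite -sumrN; apply: eq_bigr => b _.
  rewrite -sumrN; apply: eq_bigr => c _; rewrite -sumrN; apply: eq_bigr => d _.
  rewrite a12; ring.
- rewrite -sumrN; apply: eq_bigr => a _; rewrite -sumrN; apply: eq_bigr => b _.
  rewrite exchange_big -sumrN; apply: eq_bigr => c _; rewrite -sumrN; apply: eq_bigr => d _.
  rewrite a34; ring.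
- rewrite exchange_big2; apply: eq_bigr => c _.
  rewrite exchange_big2; apply: eq_bigr => d _.
  apply: eq_bigr => a _; apply: eq_bigr => b _; rewrite pr; ring.
- rewrite [X in _ + X + _]exchange_big2 -[X in _ + X](exchange_big2
    (fun b c a => \sum_d A k a * A i b * A j c * A l d * W a b c d)).
  rewrite -!big_split big1//= => a _; rewrite -!big_split big1//= => b _.
  rewrite -!big_split big1//= => c _; rewrite -!big_split big1//= => d _.
  by rewrite -[RHS](mulr0 (A i a * A j b * A k c * A l d)) -(bi a b c d); ring.
Qed.

Lemma weyl_rotate_unique (A : 'M[R]_4) lam W1 W2 : A *m A^T = 1%:M ->
  algebraic_weyl W1 -> algebraic_weyl W2 ->
  (forall x i j, x != 0 -> hquad (mcoef lam W1 i j) x =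
    \sum_a \sum_b A i a * A j b * hquad (mcoef lam W2 a b) (x *m A)) ->
  forall i j k l, W1 i j k l = rotate A W2 i j k l.
Proof.
move=> AA HW1 HW2 H i j k l; apply/eqP; rewrite -subr_eq0; apply/eqP.
apply: (@curvature_like0 (fun i j k l => W1 i j k l - rotate A W2 i j k l)).
  apply: curvature_like_sub; first exact: curvature_like_weyl.
  exact/curvature_like_rotate/curvature_like_weyl.
move=> {}i {}j x; rewrite (_ : quad _ x = quad (fun k l => W1 i k l j) x
    - quad (fun k l => rotate A W2 i k l j) x); last first.
  rewrite /quad -sumrB; apply: eq_bigr => a _; rewrite -sumrB; apply: eq_bigr => b _.
  by rewrite mulrBl.
have [->|x0] := eqVneq x 0.
  by rewrite /quad !big1 ?subrr// => a _; rewrite big1// => b _; rewrite !mxE !mulr0.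
have N : dotp (x *m A) (x *m A) = dotp x x by rewrite -!enorm_sqr enorm_orth.
have /lt0r_neq0 N0 := dotp_gt0 x0.
have := H x i j x0; rewrite /hquad N.
under [in X in _ = X -> _]eq_bigr do (under eq_bigr do rewrite mulrA; rewrite -mulr_suml).
rewrite -mulr_suml => /(mulIf (invr_neq0 (expf_neq0 2 N0))).
rewrite quad_mcoef.
under [in X in _ = X -> _]eq_bigr do (under eq_bigr do rewrite quad_mcoef N mulrDr mulrDr;
  rewrite !big_split /=).
rewrite !big_split /= -quad_rotate.
(* The [Xi] parts of both sides cancel: [A *m A^T = 1] produces the Kronecker delta here, and
   [x = (x *m A) *m A^T] produces the [x_i x_j] term below. *)
rewrite [X in _ = X + _ + _ -> _](_ : _ = - (lam / 9) * (i == j)%:R * dotp x x); last first.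
  have := congr1 (fun M : 'M[R]_4 => M i j) AA; rewrite !mxE => <-.
  move: (dotp x x) => n; rewrite mulr_sumr mulr_suml; apply: eq_bigr => a _; rewrite mxE.
  rewrite -[A j a in RHS](sum_deltar a (fun b => A j b)) !mulr_sumr mulr_suml.
  by apply: eq_bigr => b _; ring.
rewrite [X in _ = _ + X + _ -> _](_ : _ = 4 * lam / 9 * (x 0 i * x 0 j)); last first.
  have xi a : x 0 a = \sum_b A a b * (x *m A) 0 b.
    have : x 0 a = (x *m A *m A^T) 0 a by rewrite -mulmxA AA mulmx1.
    by rewrite mxE => ->; apply: eq_bigr => b _; rewrite [A^T _ _]mxE mulrC.
  rewrite [in RHS]xi [x 0 j]xi mulr_suml mulr_sumr; apply: eq_bigr => a _.
  rewrite !mulr_sumr; apply: eq_bigr => b _; ring.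
by move/addrI ->; rewrite subrr.
Qed.

End Model.


(** * Isometries between asymptotically flat metrics *)

Section Asymptotics.
Context {R : realType}.
Local Notation E4 := 'rV[R]_4.
Local Notation tensor4 := ('I_4 -> 'I_4 -> 'I_4 -> 'I_4 -> R).
Implicit Types (x y : E4) (F H : E4 -> E4) (G : E4 -> 'M[R]_4) (W : tensor4) (lam : R).

(** The form in which the expansion enters: errors o(|x|^-2) for the metric and o(|x|^-3) for its
    first derivatives, ready for limits along curves. *)
Record admissible lam W G : Prop := Admissible {
  adm_diff : \forall x \near einfty, forall i j, differentiable (fun z => G z i j) x;
  adm_sym : \forall x \near einfty, forall i j, G x i j = G x j i;
  adm_exp : forall i j, enorm x ^+ 2 *
    (G x i j - (i == j)%:R - hquad (mcoef lam W i j) x) @[x --> einfty] --> 0;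
  adm_dexp : forall i j k, enorm x ^+ 3 * (pd k (fun z => G z i j) x
    - dhquad (mcoef lam W i j) k x) @[x --> einfty] --> 0 }.

Record isometric F G1 G2 : Prop := Isometric {
  iso_diff : \forall x \near einfty, forall a, differentiable (fun z => F z 0 a) x;
  iso_pull : \forall x \near einfty, G1 x = pullback_mx F G2 x;
  iso_infty : F x @[x --> einfty] --> einfty }.

Lemma cvg_enorm : enorm x @[x --> (@einfty R)] --> +oo.
Proof. by apply/cvgryPgt => A; exact: einfty_gt. Qed.

Lemma einfty_neq0 : \forall x \near (@einfty R), x != 0.
Proof.
apply: filterS (einfty_gt 0) => x; apply: contraTneq => ->.
by rewrite enorm0 ltxx.
Qed.

Lemma cvg_inv_enorm (K : R) n : K / enorm x ^+ n.+1 @[x --> einfty] --> 0.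
Proof. exact: (cvg_comp _ _ cvg_enorm (cvg_invX K n)). Qed.

Lemma dominated_cvg0 {T : Type} (P : set_system T) {FP : Filter P} (f g : T -> R) :
  (\forall t \near P, `|f t| <= g t) -> g t @[t --> P] --> 0 -> f t @[t --> P] --> 0.
Proof.
move=> fg g0; apply/cvgrPdist_le => e e0.
have /cvgrPdist_le /(_ e e0) := g0; apply: filterS2 fg => t fgt.
by rewrite !sub0r !normrN; apply: le_trans; rewrite (le_trans fgt)// ler_norm.
Qed.

Lemma eq_cvgr {T : Type} (P : set_system T) {FP : Filter P} (f g : T -> R) (k l : R) :
  (\forall t \near P, f t = g t) -> k = l ->
  f t @[t --> P] --> k -> g t @[t --> P] --> l.
Proof. by move=> fg <- fl; apply: cvg_trans fl; apply: near_eq_cvg; apply: filterS fg. Qed.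

Lemma adm_cvg lam W G i j : admissible lam W G ->
  G x i j @[x --> einfty] --> ((i == j)%:R : R).
Proof.
move=> HG; apply/subr_cvg0.
have h0 : hquad (mcoef lam W i j) x @[x --> einfty] --> 0.
  exact: dominated_cvg0 (filterS (fun x => @hquad_bound _ _ x) einfty_neq0) (cvg_inv_enorm _ 1).
refine (eq_cvgr _ _ (cvgD (cvgM (cvg_inv_enorm 1 1) (adm_exp HG i j)) h0)).
  by apply: filterS (einfty_gt 0) => x x0; rewrite /=; field; exact: lt0r_neq0.
by rewrite mul0r addr0.
Qed.

Lemma adm_dbound lam W G : admissible lam W G ->
  exists C : R, \forall x \near einfty, forall i j k,
    `|pd k (fun z => G z i j) x| <= C / enorm x ^+ 3.
Proof.
move=> HG.
(* One constant for all entries: [6 * sumabs] comes from [dhquad_bound], and the [+ 1] absorbs the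
   o(|x|^-3) error. *)
pose C := \sum_i \sum_j (6 * sumabs (mcoef lam W i j) + 1).
have sa c : 0 <= @sumabs R c by do 2! apply: sumr_ge0 => ? _.
exists C; apply: filter_forall => i; apply: filter_forall => j; apply: filter_forall => k.
have CB : 6 * sumabs (mcoef lam W i j) + 1 <= C.
  rewrite /C (bigD1 i)//= (bigD1 j)//= -addrA lerDl.
  by rewrite addr_ge0//; do 2? apply: sumr_ge0 => ? _; rewrite ?addr_ge0 ?mulr_ge0.
have /cvgr0_norm_le /(_ 1 ltr01) := adm_dexp HG i j k.
apply: filterS2 einfty_neq0 => x x0.
have e0 := enorm_gt0 x0; have e3 : 0 < enorm x ^+ 3 by rewrite exprn_gt0.
rewrite normrM (gtr0_norm e3) mulrC -ler_pdivlMr// => H1.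
rewrite (le_trans (y := (6 * sumabs (mcoef lam W i j) + 1) / enorm x ^+ 3))//; last first.
  by rewrite ler_pM2r// invr_gt0.
rewrite -[pd _ _ _](subrK (dhquad (mcoef lam W i j) k x)) (le_trans (ler_normD _ _))//.
by rewrite mulrDl addrC lerD// dhquad_bound.
Qed.

(* Row i of the Jacobian has squared G2-norm G1_ii. *)
Lemma jac_bound lam W1 W2 F G1 G2 : admissible lam W1 G1 -> admissible lam W2 G2 ->
  isometric F G1 G2 -> \forall x \near einfty, forall i a, `|jac F x i a| <= 2.
Proof.
move=> HG1 HG2 [_ HF HFoo].
have N1 : \forall x \near einfty, forall i, `|G1 x i i - 1| <= 1.
  apply: filter_forall => i; have /cvgrPdist_le /(_ 1 ltr01) := adm_cvg (i := i) (j := i) HG1.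
  by apply: filterS => x; rewrite eqxx distrC.
(* With the entries of [G2] within 1/8 of the identity, the error in [G1_ii = sum v_a v_b G2_ab] is
   at most the sum of [(v_a^2 + v_b^2) / 16] over all 16 pairs, which is [S / 2]; hence
   [S / 2 <= G1_ii <= 2]. *)
have N2 : \forall x \near einfty, forall a b, `|G2 (F x) a b - (a == b)%:R| <= 1 / 8.
  suff N : \forall y \near einfty, forall a b, `|G2 y a b - (a == b)%:R| <= 1 / 8.
    exact: HFoo N.
  apply: filter_forall => a; apply: filter_forall => b.
  have e8 : 0 < 1 / 8 :> R by rewrite divr_gt0.
  have /cvgrPdist_le /(_ _ e8) := adm_cvg (i := a) (j := b) HG2.
  by apply: filterS => x; rewrite distrC.
apply: filterS3 HF N1 N2 => x HF N1 N2 i.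
pose v a := jac F x i a.
have G1E : G1 x i i = \sum_a \sum_b v a * v b * G2 (F x) a b.
  rewrite HF /pullback_mx mxE exchange_big; apply: eq_bigr => b _.
  rewrite mxE mulr_suml; apply: eq_bigr => a _; rewrite [_^T _ _]mxE /v; ring.
pose S := \sum_a v a ^+ 2.
have S4 : S <= 4.
  have : \sum_a \sum_b ((a == b)%:R * (v a * v b) - (v a ^+ 2 + v b ^+ 2) / 16)
      <= G1 x i i.
    rewrite G1E; apply: ler_sum => a _; apply: ler_sum => b _.
    rewrite lerBlDr -lerBlDl mulrC -mulrBr.
    have : `|v a * v b * ((a == b)%:R - G2 (F x) a b)| <= (v a ^+ 2 + v b ^+ 2) / 16.
      rewrite normrM (le_trans (ler_wpM2l (normr_ge0 _) (_ : _ <= 1 / 8)))//.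
        by rewrite distrC.
      rewrite normrM -(real_normK (num_real (v a))) -(real_normK (num_real (v b))).
      have := sqr_ge0 (`|v a| - `|v b|).
      by move: `|v a| `|v b| => p q; nra.
    exact: le_trans (ler_norm _).
  have -> : \sum_a \sum_b ((a == b)%:R * (v a * v b) - (v a ^+ 2 + v b ^+ 2) / 16)
      = S / 2.
    under eq_bigr do rewrite sumrB sum_deltar -mulr_suml big_split /= sumr_const card_ord -/S.
    rewrite sumrB -mulr_suml big_split /= sumr_const card_ord sumrMnl.
    under eq_bigr do rewrite -expr2.
    by rewrite -/S -mulr_natr; field.
  have := N1 i; rewrite ler_norml => /andP[_]; lra.
move=> a; rewrite -(@ler_pXn2r _ 2)// ?nnegrE// real_normK ?num_real//.
rewrite (le_trans _ (le_trans S4 _))//; last by lra.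
by rewrite /S (bigD1 a)//= lerDl; apply: sumr_ge0 => b _; exact: sqr_ge0.
Qed.

(* H is bounded on the sphere where the rays start, because F tends to infinity
   and F (H y) = y. *)
Lemma isometric_linear_growth lam W1 W2 F H G1 G2 : admissible lam W1 G1 ->
  admissible lam W2 G2 -> isometric F G1 G2 -> isometric H G2 G1 ->
  (\forall y \near einfty, F (H y) = y) ->
  exists2 K : R, 0 < K & \forall y \near einfty, enorm (H y) <= K * enorm y.
Proof.
move=> HG1 HG2 HF HH FH.
have [r0 r0P] := filterI (jac_bound HG2 HG1 HH) (filterI (iso_diff HH) FH).
pose r := `|r0| + 1; have r_gt0 : 0 < r by rewrite ltr_wpDl.
have {}r0P y : r <= enorm y -> [/\ forall i a, `|jac H y i a| <= 2,
    forall a, differentiable (fun z => H z 0 a) y & F (H y) = y].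
  move=> ry; have [] : [set y | (forall i a, `|jac H y i a| <= 2) /\
      (forall a, differentiable (fun z => H z 0 a) y) /\ F (H y) = y] y.
    by apply: r0P; rewrite (lt_le_trans _ ry)// (le_lt_trans (ler_norm r0))// ltrDl.
  by move=> ? [].
have [r1 r1P] := iso_infty HF (einfty_gt r).
(* The outer 2 comes from [enorm_le], [8 = 4 * 2] from [mvt_bound] with Jacobian entries at most 2,
   and [|r1| / r] covers the starting value of the ray. *)
pose K := 2 * (`|r1| / r + 8).
exists K; first by rewrite mulr_gt0// ltr_wpDl// divr_ge0// ltW.
exists r => y ry; have y0 : 0 < enorm y by exact: lt_trans ry.
rewrite /K -mulrA; apply: enorm_le => a.
(* The segment from this point to [y] is radial, so it stays outside the ball of radius [r]. *)
pose y0' := (r / enorm y) *: y.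
have ry0 : enorm y0' = r.
  by rewrite enormZ gtr0_norm ?divr_gt0// divfK// gt_eqF.
have Hy0 : enorm (H y0') <= r1.
  rewrite leNgt; apply/negP => /r1P /=.
  have ryy : r <= enorm y0' by rewrite ry0.
  by have [_ _ ->] := r0P y0' ryy; rewrite ry0 ltxx.
have seg s : 0 <= s <= 1 -> r <= enorm (y0' + s *: (y - y0')).
  move=> /andP[s0 s1].
  have -> : y0' + s *: (y - y0') = ((1 - s) * (r / enorm y) + s) *: y.
    by rewrite /y0' scalerBr scalerDl mulrBl mul1r scalerBl addrAC addrA !scalerA.
  rewrite enormZ ger0_norm.
    rewrite mulrDl -mulrA divfK ?gt_eqF//.
    rewrite -subr_ge0 (_ : _ - _ = s * (enorm y - r)); last by ring.
    by rewrite mulr_ge0// subr_ge0 ltW.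
  by rewrite addr_ge0// mulr_ge0 ?subr_ge0// divr_ge0// ltW.
have := @mvt_bound _ (fun z => H z 0 a) y0' (y - y0') 2.
rewrite (_ : y0' + (y - y0') = y); last by rewrite addrC subrK.
move=> /(_ _ _)/le_trans M.
have {}M : `|H y 0 a - H y0' 0 a| <= 8 * enorm y.
  apply: M.
  - by move=> s /seg /r0P[].
  - by move=> s j /seg /r0P[/(_ j a)]; rewrite mxE.
  - have -> : y - y0' = (1 - r / enorm y) *: y by rewrite scalerBl scale1r.
    have ry1 : r / enorm y <= 1 by rewrite ler_pdivrMr// mul1r ltW.
    rewrite enormZ ger0_norm ?subr_ge0// mulrA [leLHS]mulrC mulrA -mulrA.
    rewrite -[leRHS]mulr1 [8 * _]mulrC -!mulrA mulrC.
    have : 0 <= r / enorm y by rewrite divr_ge0// ltW.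
    by move: (r / enorm y) ry1 (enorm y) (ltW y0) => p p1 q q0 p0; nra.
rewrite -[H y 0 a](subrK (H y0' 0 a)) (le_trans (ler_normD _ _))//.
rewrite mulrDl addrC lerD//.
rewrite (le_trans (coord_le_enorm _ _))// (le_trans Hy0)// (le_trans (ler_norm _))//.
by rewrite mulrAC ler_pdivlMr// ler_wpM2l// ltW.
Qed.

(** Linear growth of [H], applied at [F x], bounds [F] from below: [enorm x = enorm (H (F x)) <= K *
    enorm (F x)]. *)
Lemma isometric_lower_bound lam W1 W2 F H G1 G2 : admissible lam W1 G1 ->
  admissible lam W2 G2 -> isometric F G1 G2 -> isometric H G2 G1 ->
  (\forall y \near einfty, F (H y) = y) -> (\forall x \near einfty, H (F x) = x) ->
  exists2 c : R, 0 < c & \forall x \near einfty, c * enorm x <= enorm (F x).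
Proof.
move=> HG1 HG2 HF HH FH HFx.
have [K K0 KP] := isometric_linear_growth HG1 HG2 HF HH FH.
exists K^-1; first by rewrite invr_gt0.
have {}KP : \forall x \near einfty, enorm (H (F x)) <= K * enorm (F x).
  exact: (iso_infty HF KP).
by apply: filterS2 HFx KP => x -> Hx; rewrite ler_pdivrMl.
Qed.

Lemma isometric_dbound lam W1 W2 F H G1 G2 : admissible lam W1 G1 ->
  admissible lam W2 G2 -> isometric F G1 G2 -> isometric H G2 G1 ->
  (\forall y \near einfty, F (H y) = y) -> (\forall x \near einfty, H (F x) = x) ->
  exists C : R, \forall x \near einfty, forall i j k,
    `|pd k (fun z => G2 z i j) (F x)| <= C / enorm x ^+ 3.
Proof.
move=> HG1 HG2 HF HH FH HFx.
have [c c0 cP] := isometric_lower_bound HG1 HG2 HF HH FH HFx.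
have [C CP] := adm_dbound HG2; exists (`|C| / c ^+ 3).
have {}CP : \forall x \near einfty, forall i j k,
    `|pd k (fun z => G2 z i j) (F x)| <= C / enorm (F x) ^+ 3 := iso_infty HF CP.
apply: filterS3 (einfty_gt 0) cP CP => x x0 cx CP i j k.
have cx0 : 0 < c * enorm x by rewrite mulr_gt0.
have Fx0 : 0 < enorm (F x) by exact: lt_le_trans cx.
rewrite (le_trans (CP i j k))// (le_trans (ler_wpM2r _ (ler_norm C)))//.
  by rewrite invr_ge0 exprn_ge0// enorm_ge0.
rewrite -mulrA ler_wpM2l// -invfM -exprMn lef_pV2 ?posrE ?exprn_gt0//.
by rewrite lerXn2r ?nnegrE ?(ltW cx0) ?(ltW Fx0).
Qed.

End Asymptotics.


(** * Second derivatives of the coordinate change *)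

Section Koszul.
Context {R : realType}.
Local Notation E4 := 'rV[R]_4.
Local Notation tensor4 := ('I_4 -> 'I_4 -> 'I_4 -> 'I_4 -> R).
Implicit Types (x y : E4) (F H : E4 -> E4) (G : E4 -> 'M[R]_4) (W : tensor4) (lam : R).

(** The inverse [H] is part of the data: its growth bounds [F] from below, and its Jacobian inverts
    that of [F]. *)
Record transition lam W1 W2 F H G1 G2 : Prop := Transition {
  tr_adm1 : admissible lam W1 G1;
  tr_adm2 : admissible lam W2 G2;
  tr_iso : isometric F G1 G2;
  tr_isoV : isometric H G2 G1;
  tr_FK : \forall x \near einfty, H (F x) = x;
  tr_HK : \forall y \near einfty, F (H y) = y;
  tr_diff2 : \forall x \near einfty, forall i a,
    differentiable (pd i (fun z => F z 0 a)) x }.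

Definition pd2 F i j a x : R := pd i (pd j (fun z => F z 0 a)) x.

(* d_k of the pullback metric minus the term where the derivative hits the
   coefficients of G2: only second derivatives of F remain. *)
Definition metric_defect F G1 G2 k i j x : R :=
  pd k (fun z => G1 z i j) x - \sum_a \sum_b \sum_c
    jac F x i a * jac F x j b * jac F x k c * pd c (fun z => G2 z a b) (F x).

Definition koszul F G1 G2 i j k x : R :=
  2^-1 * (metric_defect F G1 G2 i j k x + metric_defect F G1 G2 j i k x
          - metric_defect F G1 G2 k i j x).

(** Exteriors of balls are open, so an identity valid near infinity can be differentiated there. *)
Lemma near_einfty (P : set E4) : (\forall x \near einfty, P x) ->
  \forall x \near einfty, \forall z \near x, P z.
Proof. by move=> [r rP]; exists r => x /near_exterior; apply: filterS. Qed.

Lemma pullback_mxE F G x i j : pullback_mx F G x i j =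
  \sum_a \sum_b jac F x i a * jac F x j b * G (F x) a b.
Proof.
rewrite /pullback_mx mxE exchange_big; apply: eq_bigr => b _.
rewrite mxE mulr_suml; apply: eq_bigr => a _; rewrite [_^T _ _]mxE; ring.
Qed.

Lemma metric_defectE lam W1 W2 F H G1 G2 : transition lam W1 W2 F H G1 G2 ->
  \forall x \near einfty, forall k i j, metric_defect F G1 G2 k i j x =
    \sum_a \sum_b (pd2 F k i a x * jac F x j b + jac F x i a * pd2 F k j b x)
      * G2 (F x) a b.
Proof.
move=> T.
have dG2 : \forall x \near einfty, forall i j,
    differentiable (fun z => G2 z i j) (F x) :=
  iso_infty (tr_iso T) (adm_diff (tr_adm2 T)).
apply: filterS3 (filterI (near_einfty (iso_pull (tr_iso T))) (tr_diff2 T)) dG2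
  (iso_diff (tr_iso T)) => x [GE d2F] dG2x dF k i j.
pose J i a z := pd i (fun z => F z 0 a) z.
have dJ a b : is_derive x (delta_mx 0 k) (J a b) (pd2 F k a b x).
  by apply: derivableP; apply: diff_derivable; exact: d2F.
have dGF a b : is_derive x (delta_mx 0 k) (fun z => G2 (F z) a b)
    (\sum_c J k c x * pd c (fun z => G2 z a b) (F x)).
  rewrite -(pd_comp (f := fun z => G2 z a b))//.
  apply: derivableP; apply: diff_derivable.
  apply: (@differentiable_comp _ _ _ _ F (fun z => G2 z a b)) => //.
  exact: differentiable_vec.
have d := is_derive_sumf (fun a => is_derive_sumf (fun b =>
  is_derive_mulf (is_derive_mulf (dJ i a) (dJ j b)) (dGF a b))).
have GJ : pd k (fun z => G1 z i j) x =
    pd k (fun z => \sum_a \sum_b J i a z * J j b z * G2 (F z) a b) x.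
  apply: near_eq_derive; apply: filterS GE => z ->; rewrite pullback_mxE.
  by apply: eq_bigr => a _; apply: eq_bigr => b _; rewrite !mxE.
rewrite /metric_defect GJ (pd_val d).
rewrite -sumrB; apply: eq_bigr => a _; rewrite -sumrB; apply: eq_bigr => b _.
rewrite mulr_sumr; set s1 := \sum_c _; set s2 := \sum_c _.
have -> : s1 = s2 by apply: eq_bigr => c _; rewrite !mxE /J; ring.
rewrite addrC addKr !mxE -/(J i a x) -/(J j b x); ring.
Qed.

(** By [metric_defectE] and the symmetry of [G2], each defect is a sum [S k i j + S k j i], and [S]
    is symmetric in its first two indices because partial derivatives commute. The Koszul
    combination leaves [S i j k]. *)
Lemma koszulE lam W1 W2 F H G1 G2 : transition lam W1 W2 F H G1 G2 ->
  \forall x \near einfty, forall i j k, koszul F G1 G2 i j k x =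
    \sum_a \sum_b pd2 F i j a x * G2 (F x) a b * jac F x k b.
Proof.
move=> T.
have sG2 : \forall x \near einfty, forall i j, G2 (F x) i j = G2 (F x) j i :=
  iso_infty (tr_iso T) (adm_sym (tr_adm2 T)).
apply: filterS3 (filterI (near_einfty (iso_diff (tr_iso T))) (tr_diff2 T)) sG2
  (metric_defectE T) => x [dF d2F] sG2x E i j k.
pose S i j k := \sum_a \sum_b pd2 F i j a x * G2 (F x) a b * jac F x k b.
have sym2 a b d : pd2 F a b d x = pd2 F b a d x.
  apply: pd_comm; [|exact: d2F|exact: d2F].
  by apply: filterS dF => z; apply.
have SC a b c : S a b c = S b a c.
  rewrite /S.
  apply: eq_bigr => d _.
  apply: eq_bigr => e _.
  rewrite (sym2 a b d).
  exact: erefl.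
have ES a b c : metric_defect F G1 G2 a b c x = S a b c + S a c b.
  rewrite E; under eq_bigr do (under eq_bigr do rewrite mulrDl; rewrite big_split /=).
  rewrite big_split /=; congr (_ + _).
    by apply: eq_bigr => d _; apply: eq_bigr => e _; rewrite mulrAC.
  rewrite exchange_big; apply: eq_bigr => d _; apply: eq_bigr => e _.
  by rewrite (sG2x e d); ring.
by rewrite /koszul !ES -/(S i j k) (SC j i k) (SC k j i) (SC k i j); field.
Qed.

Lemma jac_inv lam W1 W2 F H G1 G2 : transition lam W1 W2 F H G1 G2 ->
  \forall x \near einfty, jac F x *m jac H (F x) = 1%:M.
Proof.
move=> T.
have dH : \forall x \near einfty, forall a, differentiable (fun z => H z 0 a) (F x) :=
  iso_infty (tr_iso T) (iso_diff (tr_isoV T)).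
apply: filterS3 (near_einfty (tr_FK T)) (iso_diff (tr_iso T)) dH => x FK dF dHx.
apply/matrixP => i k; rewrite !mxE.
transitivity (pd i ((fun z => H z 0 k) \o F) x).
  by rewrite pd_comp//; apply: eq_bigr => j _; rewrite !mxE.
transitivity (pd i (fun z : E4 => z 0 k) x).
  by apply: near_eq_derive; apply: filterS FK => z /= ->.
by rewrite (pd_val (is_derive_coord _ _ _)) mxE eqxx /= eq_sym.
Qed.

(** The Jacobian of [H] undoes the factor [jac F], and [G2] is replaced by the identity at the price
    of an error linear in [pd2 F] itself with small coefficients. This error is absorbed in
    [pd2_bound] and disappears in the limit in [pd2_cvg]. *)
Lemma pd2E lam W1 W2 F H G1 G2 : transition lam W1 W2 F H G1 G2 ->
  \forall x \near einfty, forall i j c, pd2 F i j c x =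
    \sum_k jac H (F x) c k * koszul F G1 G2 i j k x
    - \sum_a pd2 F i j a x * (G2 (F x) a c - (a == c)%:R).
Proof.
move=> T; apply: filterS2 (jac_inv T) (koszulE T) => x JH E i j c.
have HJ : jac H (F x) *m jac F x = 1%:M by apply: mulmx1C.
have -> : \sum_k jac H (F x) c k * koszul F G1 G2 i j k x =
    \sum_a pd2 F i j a x * G2 (F x) a c.
  under eq_bigr do rewrite E mulr_sumr.
  rewrite exchange_big; apply: eq_bigr => a _.
  under eq_bigr do rewrite mulr_sumr.
  rewrite exchange_big /= -[RHS](sum_deltar c (fun c => pd2 F i j a x * G2 (F x) a c)).
  apply: eq_bigr => b _.
  have := congr1 (fun M : 'M[R]_4 => M c b) HJ; rewrite mxE [in RHS]mxE => <-.
  by rewrite mulr_suml; apply: eq_bigr => k _; ring.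
rewrite -sumrB -[LHS](sum_deltar c (fun a => pd2 F i j a x)).
by apply: eq_bigr => a _; rewrite [c == a]eq_sym; ring.
Qed.

Lemma koszul_bound lam W1 W2 F H G1 G2 : transition lam W1 W2 F H G1 G2 ->
  exists C : R, \forall x \near einfty, forall i j k,
    `|koszul F G1 G2 i j k x| <= C / enorm x ^+ 3.
Proof.
move=> T; have [C1 C1P] := adm_dbound (tr_adm1 T).
have [C2 C2P] := isometric_dbound (tr_adm1 T) (tr_adm2 T) (tr_iso T) (tr_isoV T)
  (tr_HK T) (tr_FK T).
(* [512 = 64 * 8]: there are 64 terms, each with three Jacobian entries bounded by 2. Half the sum
   of three defects costs 3/2, rounded up to 2. *)
exists (2 * (C1 + 512 * C2)).
apply: filterS3 (jac_bound (tr_adm1 T) (tr_adm2 T) (tr_iso T)) C1P C2P.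
move=> x J2 D1 D2 i j k.
have db a b c : `|metric_defect F G1 G2 a b c x| <= (C1 + 512 * C2) / enorm x ^+ 3.
  rewrite /metric_defect (le_trans (ler_normB _ _))// [leRHS]mulrDl lerD//.
  pose B := 8 * (C2 / enorm x ^+ 3).
  have tB d e f : `|jac F x b d * jac F x c e * jac F x a f
      * pd f (fun z => G2 z d e) (F x)| <= B.
    rewrite !normrM (_ : B = 2 * 2 * 2 * (C2 / enorm x ^+ 3)); last by rewrite /B; ring.
    by rewrite !ler_pM ?mulr_ge0.
  rewrite (_ : 512 * C2 / _ = \sum_(d < 4) \sum_(e < 4) \sum_(f < 4) B).
    apply: le_trans (ler_norm_sum _ _ _) _; apply: ler_sum => d _.
    apply: le_trans (ler_norm_sum _ _ _) _; apply: ler_sum => e _.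
    by apply: le_trans (ler_norm_sum _ _ _) _; apply: ler_sum => f _.
  by rewrite !sumr_const !card_ord -!mulrnA -mulr_natr /B; ring.
have H1 := db i j k; have H2 := db j i k; have H3 := db k i j.
rewrite /koszul normrM ger0_norm ?invr_ge0// ler_pdivrMl//.
rewrite (le_trans (ler_normB _ _))// (le_trans (lerD (ler_normD _ _) (lexx _)))//.
rewrite (le_trans (lerD (lerD H1 H2) H3))//.
move: (le_trans (normr_ge0 _) H1); rewrite -!mulrA; move: (_ / enorm x ^+ 3) => u; lra.
Qed.

Lemma pd2_bound lam W1 W2 F H G1 G2 : transition lam W1 W2 F H G1 G2 ->
  exists C : R, \forall x \near einfty, forall i j a,
    `|pd2 F i j a x| <= C / enorm x ^+ 3.
Proof.
move=> T; have [C CP] := koszul_bound T; exists (64 * C).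
have N2 : \forall x \near einfty, forall a b,
    `|G2 (F x) a b - (a == b)%:R| <= 1 / 8.
  suff N : \forall y \near einfty, forall a b, `|G2 y a b - (a == b)%:R| <= 1 / 8.
    exact: iso_infty (tr_iso T) _ N.
  apply: filter_forall => a; apply: filter_forall => b.
  have e8 : 0 < 1 / 8 :> R by rewrite divr_gt0.
  have /cvgrPdist_le /(_ _ e8) := adm_cvg (i := a) (j := b) (tr_adm2 T).
  by apply: filterS => x; rewrite distrC.
have H2 : \forall x \near einfty, forall i a, `|jac H (F x) i a| <= 2 :=
  iso_infty (tr_iso T) (jac_bound (tr_adm2 T) (tr_adm1 T) (tr_isoV T)).
apply: filterS3 (filterI (pd2E T) CP) N2 H2 => x [E Cx] Gx Hx i j a.
(* Absorption: summing the four bounds [8 * k + S / 8] gives [S <= 32 * k + S / 2], hence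
   [S <= 64 * k]. *)
pose k := C / enorm x ^+ 3; pose S := \sum_b `|pd2 F i j b x|.
have b c : `|pd2 F i j c x| <= 8 * k + S / 8.
  rewrite E (le_trans (ler_normB _ _))// lerD//.
    rewrite (le_trans (ler_norm_sum _ _ _))//.
    rewrite (le_trans (ler_sum _ (G := fun=> 2 * k) _))//.
      by move=> d _; rewrite normrM ler_pM.
    by rewrite sumr_const card_ord -[X in X <= _]mulr_natr (_ : 2 * k * 4 = 8 * k)//; ring.
  rewrite (le_trans (ler_norm_sum _ _ _))// /S mulr_suml; apply: ler_sum => d _.
  by rewrite normrM ler_wpM2l// -[_^-1]mul1r.
have S64 : S <= 64 * k.
  have : S <= \sum_(c < 4) (8 * k + S / 8) by apply: ler_sum => c _.
  by rewrite sumr_const card_ord -mulr_natr; lra.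
rewrite -mulrA -/k (le_trans _ S64)// /S (bigD1 a)//= lerDl.
by apply: sumr_ge0.
Qed.

End Koszul.


(** * Limits along rays *)

Section Rays.
Context {R : realType}.
Local Notation E4 := 'rV[R]_4.
Local Notation tensor4 := ('I_4 -> 'I_4 -> 'I_4 -> 'I_4 -> R).
Implicit Types (x y u : E4) (F H : E4 -> E4) (G : E4 -> 'M[R]_4) (W : tensor4) (lam : R).

Lemma cvg_rowP {T : Type} (P : set_system T) {FP : Filter P} (f : T -> E4) u :
  (forall i, f t 0 i @[t --> P] --> u 0 i) -> f t @[t --> P] --> u.
Proof.
move=> fu A [Q Qu QA].
have : \forall t \near P, forall i j, Q i j (f t i j).
  apply: filter_forall => i; apply: filter_forall => j; rewrite (ord1 i).
  by apply: fu; have := Qu 0 j.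
by apply: filterS => t Qt; apply: QA.
Qed.

(** Stated along a curve asymptotic to [t *: u] because [G2] is evaluated at [F (t *: x)], which
    need not run along a ray. The derivative of the leading term is homogeneous of degree -3, so
    [t ^+ 3] times its value at [y t] is its value at [t^-1 *: y t], and continuity at [u] gives the
    limit. *)
Lemma adm_dcvg_curve lam W G i j k (y : R -> E4) u : admissible lam W G ->
  y t @[t --> +oo] --> einfty -> u != 0 -> t^-1 *: y t @[t --> +oo] --> u ->
  t ^+ 3 * pd k (fun z => G z i j) (y t) @[t --> +oo] -->
    dhquad (mcoef lam W i j) k u.
Proof.
move=> HG yoo u0 yu; set c := mcoef lam W i j.
have E := cvg_comp _ _ yoo (adm_dexp HG i j k).
have cont_d : dhquad c k (t^-1 *: y t) @[t --> +oo] --> dhquad c k u.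
  apply: (cvg_comp _ _ yu).
  exact: (differentiable_continuous (differentiable_dhquad c k u0)).
have cont_e : enorm (t^-1 *: y t) @[t --> +oo] --> enorm u.
  by apply: (cvg_comp _ _ yu); exact: continuous_enorm.
have e0 := enorm_gt0 u0.
have cont_e3 : (enorm (t^-1 *: y t) ^+ 3)^-1 @[t --> +oo] --> (enorm u ^+ 3)^-1.
  apply: cvgV; first by rewrite expf_neq0// gt_eqF.
  by apply: (cvg_comp (fun t => enorm (t^-1 *: y t)) (fun r : R => r ^+ 3) cont_e);
    exact: exprn_continuous.
refine (eq_cvgr _ _ (cvgD (cvgM E cont_e3) cont_d)); last by rewrite mul0r add0r.
have ep : \forall t \near +oo, 0 < enorm (t^-1 *: y t).
  have /cvgrPdist_lt /(_ _ e0) := cont_e.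
  by apply: filterS => t; rewrite ltr_distlC subrr => /andP[].
apply: filterS2 (nbhs_pinfty_gt (num_real (0 : R))) ep => t t0.
set v := t^-1 *: y t => et; have yE : y t = t *: v by rewrite scalerA divff ?scale1r// gt_eqF.
have v0 : v != 0.
  by apply: contraTneq et => ->; rewrite enorm0 ltxx.
rewrite /= -/c -/v; clearbody v; rewrite yE enormZ (gtr0_norm t0) dhquadZ ?gt_eqF//.
move: (pd _ _ _) (dhquad c k v) => p d.
by field; rewrite !gt_eqF.
Qed.

Lemma transition_limits lam W1 W2 F H G1 G2 : transition lam W1 W2 F H G1 G2 ->
  exists (A : 'M[R]_4) (c : E4) (K : R), \forall x \near einfty,
    (forall j a, `|jac F x j a - A j a| <= K / enorm x ^+ 2) /\
    (forall a, `|F x 0 a - (x *m A) 0 a - c 0 a| <= K / enorm x).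
Proof.
move=> T; have [C CP] := pd2_bound T.
have H1 (p : 'I_4 * 'I_4) : exists q : R * R, \forall x \near einfty,
    `|jac F x p.1 p.2 - q.1| <= q.2 / enorm x ^+ 2.
  have [c [K cK]] := @cvg_einfty_pd _ (pd p.1 (fun z => F z 0 p.2)) 1 C
     (filterS (fun x (h : forall i a, _) => h p.1 p.2) (tr_diff2 T))
     (filterS (fun x (h : forall i j a, _) i => h i p.1 p.2) CP).
  by exists (c, K); apply: filterS cK => x; rewrite mxE.
have [q qP] := choice H1.
pose A : 'M[R]_4 := \matrix_(j, a) (q (j, a)).1.
pose K0 := \sum_j \sum_a `|(q (j, a)).2|.
have AP : \forall x \near einfty, forall j a, `|jac F x j a - A j a| <= K0 / enorm x ^+ 2.
  apply: filter_forall => j; apply: filter_forall => a.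
  apply: filterS2 (einfty_gt 0) (qP (j, a)) => x x0 h.
  rewrite [A j a]mxE (le_trans h)// ler_pM2r ?invr_gt0 ?exprn_gt0// (le_trans (ler_norm _))//.
  rewrite /K0 (bigD1 j)//= (bigD1 a)//= -addrA lerDl.
  by rewrite addr_ge0//; do 2? apply: sumr_ge0 => ? _.
(* Subtracting the limiting linear map leaves a function with gradient O(|x|^-2), to which the lemma
   used for the Jacobian entries applies again, one power lower. *)
have H2 (a : 'I_4) : exists q : R * R, \forall x \near einfty,
    `|F x 0 a - (x *m A) 0 a - q.1| <= q.2 / enorm x.
  pose L (z : E4) := \sum_i z 0 i * A i a.
  have dL x : differentiable L x.
    apply: differentiable_sumf => i; apply: differentiable_mulf => //.
    exact: differentiable_coord.
  have pL j x : pd j L x = A j a.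
    have := is_derive_sumf (fun i => is_derive_mulf (is_derive_coord x (delta_mx 0 j) i)
      (is_derive_cst (A i a) x (delta_mx 0 j))).
    move/pd_val => ->; rewrite -[RHS](sum_deltar j (fun i => A i a)).
    by apply: eq_bigr => i _; rewrite !mxE eqxx /= [i == j]eq_sym /cst; ring.
  have d0 : \forall x \near einfty, differentiable (fun z => F z 0 a - L z) x.
    by apply: filterS (iso_diff (tr_iso T)) => x dF; exact: differentiableB.
  have p0 : \forall x \near einfty, forall j,
      `|pd j (fun z => F z 0 a - L z) x| <= K0 / enorm x ^+ 2.
    apply: filterS2 (iso_diff (tr_iso T)) AP => x dF Ax j.
    rewrite /pd deriveB; [|exact: diff_derivable|exact: diff_derivable].
    by have := Ax j a; rewrite [jac _ _ _ _]mxE -(pL j x).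
  have [c [K cK]] := cvg_einfty_pd (n := 0) d0 p0.
  by exists (c, K); apply: filterS cK => x; rewrite /L mxE expr1.
have [q' q'P] := choice H2.
pose K1 := \sum_a `|(q' a).2|.
have K00 : 0 <= K0 by do 2! apply: sumr_ge0 => ? _.
have K10 : 0 <= K1 by apply: sumr_ge0 => ? _.
exists A, (\row_a (q' a).1), (K0 + K1).
have N : \forall x \near einfty, forall a,
    `|F x 0 a - (x *m A) 0 a - (q' a).1| <= (q' a).2 / enorm x by exact: filter_forall.
apply: filterS3 (einfty_gt 0) AP N => x x0 Ax Nx; split=> [j a|a].
  by rewrite (le_trans (Ax j a))// ler_pM2r ?invr_gt0 ?exprn_gt0// lerDl.
rewrite [(\row__ _) _ _]mxE (le_trans (Nx a))// ler_pM2r ?invr_gt0// (le_trans (ler_norm _))//.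
rewrite (le_trans (y := K1)) ?lerDr// /K1 (bigD1 a)//= lerDl.
by apply: sumr_ge0.
Qed.

End Rays.

(** * Algebra of the limits along a ray *)

Section LimitAlgebra.
Context {R : realType}.
Local Notation E4 := 'rV[R]_4.
Local Notation tensor4 := ('I_4 -> 'I_4 -> 'I_4 -> 'I_4 -> R).
Variables (A : 'M[R]_4) (lam : R) (W1 W2 : tensor4) (x : E4).

(** [lim_defect] and [lim_koszul] are the limits of [t ^+ 3] times [metric_defect] and [koszul] at
    [t *: x]; [lim_metric] is h(x). *)
Definition lim_defect k i j : R := dhquad (mcoef lam W1 i j) k x
  - \sum_a \sum_b \sum_c A i a * A j b * A k c * dhquad (mcoef lam W2 a b) c (x *m A).

Definition lim_koszul i j k : R :=
  2^-1 * (lim_defect i j k + lim_defect j i k - lim_defect k i j).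

Definition lim_metric j k : R := hquad (mcoef lam W1 j k) x
  - \sum_a \sum_b A j a * A k b * hquad (mcoef lam W2 a b) (x *m A).

Hypotheses (AA : A *m A^T = 1%:M) (x0 : x != 0).
Hypotheses (HW1 : algebraic_weyl W1) (HW2 : algebraic_weyl W2).

Lemma rotated_neq0 : x *m A != 0.
Proof.
apply: contra x0 => /eqP xA0; apply/eqP.
by rewrite -[x]mulmx1 -AA mulmxA xA0 mul0mx.
Qed.

(** The radial derivative contributes [- 2 h] by Euler's identity. The other two defects cancel: by
    [dhquad_mcoef_contract] the contracted derivatives are symmetric in the free indices, for [W1]
    at [x] and for [W2] at [x *m A] separately. The factor 1/2 leaves [- h]. *)
Lemma lim_koszul_contract j k :
  \sum_i x 0 i * lim_koszul i j k = - lim_metric j k.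
Proof.
have y0 := rotated_neq0; set y := x *m A in y0 *.
have yE a : y 0 a = \sum_i x 0 i * A i a by rewrite mxE.
have T1 : \sum_i x 0 i * lim_defect i j k = - 2 * lim_metric j k.
  rewrite /lim_defect /lim_metric; under eq_bigr do rewrite mulrBr.
  rewrite sumrB dhquad_euler// mulrBr; congr (_ - _).
  under eq_bigr do rewrite mulr_sumr.
  rewrite exchange_big mulr_sumr; apply: eq_bigr => a _.
  under eq_bigr do rewrite mulr_sumr.
  rewrite exchange_big mulr_sumr; apply: eq_bigr => b _.
  rewrite mulrCA -(dhquad_euler _ y0).
  under eq_bigr do rewrite mulr_sumr.
  rewrite exchange_big mulr_sumr; apply: eq_bigr => c _.
  rewrite yE mulr_suml mulr_sumr; apply: eq_bigr => i _; ring.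
pose M c b := \sum_a y 0 a * dhquad (mcoef lam W2 a b) c y.
have T2 m l : \sum_i x 0 i * lim_defect m i l =
    \sum_i x 0 i * dhquad (mcoef lam W1 i l) m x
    - \sum_b \sum_c A l b * A m c * M c b.
  rewrite /lim_defect; under eq_bigr do rewrite mulrBr.
  rewrite sumrB; congr (_ - _).
  transitivity (\sum_a \sum_b \sum_c y 0 a * (A l b * A m c * dhquad (mcoef lam W2 a b) c y)).
    under eq_bigr do rewrite mulr_sumr.
    rewrite exchange_big; apply: eq_bigr => a _.
    under eq_bigr do rewrite mulr_sumr.
    rewrite exchange_big; apply: eq_bigr => b _.
    under eq_bigr do rewrite mulr_sumr.
    rewrite exchange_big; apply: eq_bigr => c _.
    rewrite yE mulr_suml; apply: eq_bigr => i _; ring.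
  rewrite exchange_big; apply: eq_bigr => b _.
  rewrite exchange_big; apply: eq_bigr => c _.
  rewrite /M mulr_sumr; apply: eq_bigr => a _; ring.
rewrite /lim_koszul; under eq_bigr do rewrite mulrCA.
rewrite -mulr_sumr; under eq_bigr do rewrite mulrBr mulrDr.
rewrite sumrB big_split /= T1.
have -> : \sum_i x 0 i * lim_defect j i k = \sum_i x 0 i * lim_defect k i j.
  rewrite !T2 dhquad_mcoef_contract//; congr (_ - _).
  rewrite exchange_big; apply: eq_bigr => c _; apply: eq_bigr => b _.
  by rewrite {1}/M dhquad_mcoef_contract// [A k b * _]mulrC.
by rewrite addrK mulrA mulrN mulVf// mulN1r.
Qed.

(** Both leading terms have the radial contraction [lam / 3 * x_k / |x|^2], with the same [lam], and
    the orthogonal matrix [A] carries the one at [x *m A] to the one at [x]. *)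
Lemma lim_metric_contract k : \sum_j x 0 j * lim_metric j k = 0.
Proof.
have N : dotp (x *m A) (x *m A) = dotp x x by rewrite -!enorm_sqr enorm_orth.
rewrite /lim_metric; under eq_bigr do rewrite mulrBr.
rewrite sumrB; apply/eqP; rewrite subr_eq0; apply/eqP.
under eq_bigr do rewrite hquad_mcoef_sym//.
rewrite hquad_mcoef_contract//.
transitivity (\sum_b A k b * \sum_a (x *m A) 0 a * hquad (mcoef lam W2 b a) (x *m A)).
  under eq_bigr do rewrite hquad_mcoef_contract// N.
  have xk : x 0 k = \sum_b A k b * (x *m A) 0 b.
    have : x 0 k = (x *m A *m A^T) 0 k by rewrite -mulmxA AA mulmx1.
    by rewrite mxE => ->; apply: eq_bigr => b _; rewrite [A^T _ _]mxE mulrC.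
  by rewrite {1}xk mulr_sumr mulr_suml; apply: eq_bigr => b _; ring.
symmetry; under eq_bigr do rewrite mulr_sumr.
rewrite exchange_big; under eq_bigr do under eq_bigr do rewrite mulr_sumr.
under eq_bigr do rewrite exchange_big.
rewrite exchange_big; apply: eq_bigr => b _; rewrite mulr_sumr; apply: eq_bigr => a _.
rewrite [(x *m A) 0 a in RHS]mxE mulr_suml mulr_sumr; apply: eq_bigr => i _.
by rewrite (hquad_mcoef_sym _ b a)//; ring.
Qed.

End LimitAlgebra.


(** * Limits for the coordinate change and the vanishing of h *)

Section Rigidity.
Context {R : realType}.
Local Notation E4 := 'rV[R]_4.
Local Notation tensor4 := ('I_4 -> 'I_4 -> 'I_4 -> 'I_4 -> R).
Implicit Types (x y u : E4) (F H : E4 -> E4) (G : E4 -> 'M[R]_4) (W : tensor4) (lam : R).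

Lemma bounded_cvg0 {T : Type} (P : set_system T) {FP : Filter P} (f g : T -> R) (B : R) :
  (\forall t \near P, `|g t| <= B) -> f t @[t --> P] --> 0 ->
  f t * g t @[t --> P] --> 0.
Proof.
move=> gB f0; have f0' : `|f t| @[t --> P] --> 0.
  by refine (eq_cvgr _ (normr0 R) (cvg_norm f0)); exact: nearW.
apply: (dominated_cvg0 (g := fun t => `|f t| * B)).
  by apply: filterS gB => t gt; rewrite normrM ler_wpM2l.
by refine (eq_cvgr _ (mul0r B) (cvgM f0' (cvg_cst B))); exact: nearW.
Qed.

Variables (lam : R) (W1 W2 : tensor4) (F H : E4 -> E4) (G1 G2 : E4 -> 'M[R]_4).
Hypothesis T : transition lam W1 W2 F H G1 G2.
Hypotheses (HW1 : algebraic_weyl W1) (HW2 : algebraic_weyl W2).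
Variables (A : 'M[R]_4) (c : E4) (K : R).
Hypothesis AK : \forall x \near einfty,
    (forall j a, `|jac F x j a - A j a| <= K / enorm x ^+ 2) /\
    (forall a, `|F x 0 a - (x *m A) 0 a - c 0 a| <= K / enorm x).

Lemma jac_cvg j a : jac F x j a @[x --> einfty] --> A j a.
Proof.
apply/subr_cvg0; apply: dominated_cvg0 (cvg_inv_enorm K 1).
by apply: filterS AK => x [].
Qed.

Lemma metric_cvg a b : G2 (F x) a b @[x --> einfty] --> ((a == b)%:R : R).
Proof. exact: (cvg_comp _ _ (iso_infty (tr_iso T)) (adm_cvg (tr_adm2 T))). Qed.

(** Both metrics tend to the identity, so the pullback identity becomes [1 = A *m A^T] in the
    limit. *)
Lemma limit_orthogonal : A *m A^T = 1%:M.
Proof.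
apply/matrixP => i j.
have L : \sum_a \sum_b jac F x i a * jac F x j b * G2 (F x) a b @[x --> einfty] -->
    \sum_a \sum_b A i a * A j b * (a == b)%:R.
  apply: cvg_sumr => a; apply: cvg_sumr => b.
  refine (eq_cvgr _ (erefl _) (cvgM (cvgM (@jac_cvg i a) (@jac_cvg j b)) (@metric_cvg a b))).
  exact: nearW.
have L' : G1 x i j @[x --> einfty] --> \sum_a \sum_b A i a * A j b * (a == b)%:R.
  refine (eq_cvgr _ (erefl _) L).
  by apply: filterS (iso_pull (tr_iso T)) => x ->; rewrite pullback_mxE.
have : (i == j)%:R = \sum_a \sum_b A i a * A j b * (a == b)%:R.
  exact: norm_cvg_unique (adm_cvg (i := i) (j := j) (tr_adm1 T)) L'.
move=> E; rewrite [RHS]mxE E mxE; apply: eq_bigr => a _.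
rewrite mxE -[A j a in LHS](sum_deltar a (fun b => A j b)) mulr_sumr.
by apply: eq_bigr => b _; ring.
Qed.

(** [jac H - A^T] equals [(1 - A^T *m jac F) *m jac H], where the first factor tends to 0 because
    [A^T *m A = 1] and the second is bounded by [jac_bound]. *)
Lemma jacV_cvg a k : jac H (F x) a k @[x --> einfty] --> A k a.
Proof.
have H2 : \forall x \near einfty, forall i a, `|jac H (F x) i a| <= 2 :=
  iso_infty (tr_iso T) (jac_bound (tr_adm2 T) (tr_adm1 T) (tr_isoV T)).
have AtA : A^T *m A = 1%:M by apply: mulmx1C; exact: limit_orthogonal.
have L : \sum_b ((a == b)%:R - \sum_i A i a * jac F x i b) * jac H (F x) b k
    @[x --> einfty] --> \sum_(b < 4) (0 : R).
  apply: cvg_sumr => b; apply: (bounded_cvg0 (B := 2)).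
    exact: (filterS (fun x h => h b k) H2).
  have E : (a == b)%:R - \sum_i A i a * A i b = 0 :> R.
    have := congr1 (fun M : 'M[R]_4 => M a b) AtA; rewrite mxE [in RHS]mxE => <-.
    by apply/eqP; rewrite subr_eq0; apply/eqP; apply: eq_bigr => i _; rewrite mxE.
  have S : \sum_i A i a * jac F x i b @[x --> einfty] --> \sum_i A i a * A i b.
    by apply: cvg_sumr => i; apply: cvgMl_tmp; exact: jac_cvg.
  refine (eq_cvgr _ E (cvgB (cvg_cst ((a == b)%:R : R)) S)); exact: nearW.
apply/subr_cvg0; refine (eq_cvgr _ _ L); last by rewrite big1.
apply: filterS (jac_inv T) => x JH; under eq_bigr do rewrite mulrBl.
rewrite sumrB sum_deltar; congr (_ - _).
under eq_bigr do rewrite mulr_suml.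
rewrite exchange_big -[RHS](sum_deltar k (fun i => A i a)); apply: eq_bigr => i _.
have := congr1 (fun M : 'M[R]_4 => M i k) JH; rewrite mxE [in RHS]mxE eq_sym => <-.
by rewrite mulr_suml; apply: eq_bigr => b _; ring.
Qed.

Section Ray.
Variable x : E4.
Hypothesis x0 : x != 0.

Lemma enorm_ray : \forall t \near +oo, enorm (t *: x) = t * enorm x.
Proof.
apply: filterS (nbhs_pinfty_gt (num_real (0 : R))) => t t0.
by rewrite enormZ gtr0_norm.
Qed.

Definition remainder a (t : R) : R := F (t *: x) 0 a - t * (x *m A) 0 a - c 0 a.

Lemma remainder_cvg a : remainder a t @[t --> +oo] --> 0.
Proof.
apply: dominated_cvg0 (cvg_comp _ _ (cvg_ray x0) (cvg_inv_enorm K 0)).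
have N : \forall z \near einfty, `|F z 0 a - (z *m A) 0 a - c 0 a| <= K / enorm z ^+ 1.
  by apply: filterS AK => z []; rewrite expr1.
have N' : \forall t \near +oo, `|F (t *: x) 0 a - ((t *: x) *m A) 0 a - c 0 a|
    <= K / enorm (t *: x) ^+ 1 := cvg_ray x0 N.
by apply: filterS N' => t /=; rewrite /remainder -scalemxAl mxE.
Qed.

Lemma direction_cvg : t^-1 *: F (t *: x) @[t --> +oo] --> x *m A.
Proof.
apply: cvg_rowP => a.
refine (eq_cvgr _ _ (cvgD (cvgD (cvgM (cvg_invX 1 0) (@remainder_cvg a))
  (cvg_invX (c 0 a) 0)) (cvg_cst ((x *m A) 0 a)))); last by rewrite mul0r !add0r.
apply: filterS (nbhs_pinfty_gt (num_real (0 : R))) => t t0.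
rewrite [RHS]mxE -[LHS]/(1 / t * remainder a t + c 0 a / t + (x *m A) 0 a) /remainder.
by field; rewrite gt_eqF.
Qed.

Lemma defect_cvg k i j : t ^+ 3 * metric_defect F G1 G2 k i j (t *: x) @[t --> +oo] -->
  lim_defect A lam W1 W2 x k i j.
Proof.
have xx : t^-1 *: (t *: x) @[t --> +oo] --> x.
  apply: cvg_near_cst; apply: filterS (nbhs_pinfty_gt (num_real (0 : R))) => t t0.
  by rewrite scalerA mulVf ?scale1r// gt_eqF.
have L1 := adm_dcvg_curve (i := i) (j := j) (k := k) (tr_adm1 T) (cvg_ray x0) x0 xx.
have Foo := cvg_comp _ _ (cvg_ray x0) (iso_infty (tr_iso T)).
have L2 a b m := adm_dcvg_curve (i := a) (j := b) (k := m) (tr_adm2 T) Foo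
  (rotated_neq0 limit_orthogonal x0) direction_cvg.
have L3 : \sum_a \sum_b \sum_m jac F (t *: x) i a * jac F (t *: x) j b * jac F (t *: x) k m
     * (t ^+ 3 * pd m (fun z => G2 z a b) (F (t *: x))) @[t --> +oo] -->
    \sum_a \sum_b \sum_m A i a * A j b * A k m * dhquad (mcoef lam W2 a b) m (x *m A).
  apply: cvg_sumr => a; apply: cvg_sumr => b; apply: cvg_sumr => m.
  have J p q := cvg_comp _ _ (cvg_ray x0) (@jac_cvg p q).
  refine (eq_cvgr _ (erefl _) (cvgM (cvgM (cvgM (J i a) (J j b)) (J k m)) (L2 a b m))).
  exact: nearW.
refine (eq_cvgr _ (erefl _) (cvgB L1 L3)).
apply: nearW => t; rewrite /= /metric_defect mulrBr; congr (_ - _).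
rewrite mulr_sumr; apply: eq_bigr => a _; rewrite mulr_sumr; apply: eq_bigr => b _.
by rewrite mulr_sumr; apply: eq_bigr => m _; ring.
Qed.

Lemma koszul_cvg i j k : t ^+ 3 * koszul F G1 G2 i j k (t *: x) @[t --> +oo] -->
  lim_koszul A lam W1 W2 x i j k.
Proof.
refine (eq_cvgr _ _ (cvgM (cvg_cst (2^-1 : R)) (cvgB (cvgD (@defect_cvg i j k)
  (@defect_cvg j i k)) (@defect_cvg k i j)))); last by [].
by apply: nearW => t; rewrite ?fctE /= /koszul; ring.
Qed.

(** In [pd2E] the correction is [G2 - 1], which tends to 0, times [t ^+ 3 * pd2 F], which
    [pd2_bound] keeps bounded; only the Koszul term survives. *)
Lemma pd2_cvg i j a : t ^+ 3 * pd2 F i j a (t *: x) @[t --> +oo] -->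
  \sum_k A k a * lim_koszul A lam W1 W2 x i j k.
Proof.
have [C CP] := pd2_bound T.
have bd b : \forall t \near +oo, `|t ^+ 3 * pd2 F i j b (t *: x)| <= C / enorm x ^+ 3.
  have N : \forall t \near +oo, forall i j a,
    `|pd2 F i j a (t *: x)| <= C / enorm (t *: x) ^+ 3 := cvg_ray x0 CP.
  apply: filterS3 (nbhs_pinfty_gt (num_real (0 : R))) enorm_ray N => t t0 -> N.
  rewrite normrM gtr0_norm ?exprn_gt0// (le_trans (ler_wpM2l _ (N i j b)))//.
    by rewrite exprn_ge0// ltW.
  rewrite exprMn le_eqVlt; apply/orP; left; apply/eqP; field.
  by rewrite !gt_eqF ?enorm_gt0.
have R0 b : (G2 (F (t *: x)) b a - (b == a)%:R) * (t ^+ 3 * pd2 F i j b (t *: x))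
    @[t --> +oo] --> 0.
  apply: (bounded_cvg0 (B := C / enorm x ^+ 3)) => //.
  by apply/subr_cvg0; exact: (cvg_comp _ _ (cvg_ray x0) (@metric_cvg b a)).
have L1 : \sum_k jac H (F (t *: x)) a k * (t ^+ 3 * koszul F G1 G2 i j k (t *: x))
    @[t --> +oo] --> \sum_k A k a * lim_koszul A lam W1 W2 x i j k.
  apply: cvg_sumr => k.
  refine (eq_cvgr _ (erefl _) (cvgM (cvg_comp _ _ (cvg_ray x0) (@jacV_cvg a k))
    (@koszul_cvg i j k))); exact: nearW.
have L2 : \sum_b (G2 (F (t *: x)) b a - (b == a)%:R) * (t ^+ 3 * pd2 F i j b (t *: x))
    @[t --> +oo] --> \sum_(b < 4) (0 : R) by apply: cvg_sumr => b; exact: R0.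
have E : \forall t \near +oo, forall i j c, pd2 F i j c (t *: x) =
    \sum_k jac H (F (t *: x)) c k * koszul F G1 G2 i j k (t *: x)
    - \sum_a pd2 F i j a (t *: x) * (G2 (F (t *: x)) a c - (a == c)%:R) :=
  cvg_ray x0 (pd2E T).
refine (eq_cvgr _ _ (cvgB L1 L2)); last by rewrite [X in _ - X]big1 ?subr0.
apply: filterS E => t E; rewrite ?fctE /= [in RHS]E mulrBr; congr (_ - _).
  by rewrite mulr_sumr; apply: eq_bigr => k _; ring.
by rewrite mulr_sumr; apply: eq_bigr => k _; ring.
Qed.

Definition lim_jac j a : R := 2^-1 * \sum_k A k a * lim_metric A lam W1 W2 x j k.

Lemma jac_expansion j a :
  t ^+ 2 * (jac F (t *: x) j a - A j a) @[t --> +oo] --> lim_jac j a.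
Proof.
have dJ : \forall t \near +oo, is_derive (t : R) 1
    (fun t => jac F (t *: x) j a - A j a) (\sum_i x 0 i * pd2 F i j a (t *: x)).
  have d2 : \forall t \near +oo, forall i a,
    differentiable (pd i (fun z => F z 0 a)) (t *: x) := cvg_ray x0 (tr_diff2 T).
  apply: filterS d2 => t d2.
  have d := is_derive_ray (d2 j a); rewrite derive_pd// in d.
  have := @is_deriveB _ _ _ _ _ t 1 _ _ d (is_derive_cst (A j a) t 1); rewrite subr0.
  by congr is_derive; apply/funext => s; rewrite /= mxE.
have J0 : jac F (t *: x) j a - A j a @[t --> +oo] --> 0.
  by apply/subr_cvg0; exact: (cvg_comp _ _ (cvg_ray x0) (@jac_cvg j a)).
have L : t ^+ 3 * \sum_i x 0 i * pd2 F i j a (t *: x) @[t --> +oo] -->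
    \sum_i x 0 i * \sum_k A k a * lim_koszul A lam W1 W2 x i j k.
  have L : \sum_i x 0 i * (t ^+ 3 * pd2 F i j a (t *: x)) @[t --> +oo] -->
    \sum_i x 0 i * \sum_k A k a * lim_koszul A lam W1 W2 x i j k.
    by apply: cvg_sumr => i; apply: cvgMl_tmp; exact: pd2_cvg.
  refine (eq_cvgr _ (erefl _) L); apply: nearW => t.
  by rewrite mulr_sumr; apply: eq_bigr => i _; ring.
(* Radial integration only sees the second derivatives contracted with [x]. By [lim_koszul_contract]
   these give [- h A], and [decay_limit] with [n = 1] turns this into [h A / 2]. *)
refine (eq_cvgr _ _ (decay_limit dJ J0 L)); first exact: nearW.

have -> : \sum_i x 0 i * \sum_k A k a * lim_koszul A lam W1 W2 x i j k =
    - \sum_k A k a * lim_metric A lam W1 W2 x j k; last by rewrite /lim_jac mulNr opprK mulrC.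
under eq_bigr do rewrite mulr_sumr.
rewrite exchange_big -sumrN; apply: eq_bigr => k _.
rewrite -mulrN -(lim_koszul_contract lam limit_orthogonal x0 HW1 HW2).
by rewrite mulr_sumr; apply: eq_bigr => i _; ring.
Qed.

Lemma remainder_expansion a : t * remainder a t @[t --> +oo] --> 0.
Proof.
have dr : \forall t \near +oo, is_derive (t : R) 1 (remainder a)
    (\sum_j x 0 j * (jac F (t *: x) j a - A j a)).
  have d1 : \forall t \near +oo, forall a,
    differentiable (fun z => F z 0 a) (t *: x) := cvg_ray x0 (iso_diff (tr_iso T)).
  apply: filterS d1 => t d1.
  have dF := is_derive_ray (d1 a); rewrite derive_pd// in dF.
  have dt : is_derive t 1 (fun t : R => t * (x *m A) 0 a) ((x *m A) 0 a).
    have := @is_deriveM _ _ id (cst ((x *m A) 0 a)) t 1 1 0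
      (is_derive_id _ _) (is_derive_cst _ _ _).
    by rewrite /GRing.scale /= mulr0 add0r mulr1.
  have := is_deriveB (is_deriveB dF dt) (is_derive_cst (c 0 a) t 1).
  congr is_derive; rewrite subr0 [(x *m A) 0 a]mxE -sumrB; apply: eq_bigr => j _.
  by rewrite mulrBr mxE.
have L : t ^+ 2 * \sum_j x 0 j * (jac F (t *: x) j a - A j a) @[t --> +oo] -->
    \sum_j x 0 j * lim_jac j a.
  have L : \sum_j x 0 j * (t ^+ 2 * (jac F (t *: x) j a - A j a)) @[t --> +oo] -->
    \sum_j x 0 j * lim_jac j a.
    by apply: cvg_sumr => j; apply: cvgMl_tmp; exact: jac_expansion.
  refine (eq_cvgr _ (erefl _) L); apply: nearW => t.
  by rewrite mulr_sumr; apply: eq_bigr => j _; ring.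
refine (eq_cvgr _ _ (decay_limit dr (@remainder_cvg a) L)); first exact: nearW.
(* Up to sign the limit is [x V(x) = (x h(x)) A / 2], which [lim_metric_contract] annihilates. *)
apply/eqP; rewrite oppr_eq0 mulf_eq0; apply/orP; left; apply/eqP.
transitivity (2^-1 * \sum_k A k a * \sum_j x 0 j * lim_metric A lam W1 W2 x j k).
  rewrite mulr_sumr; under eq_bigr do rewrite /lim_jac mulr_sumr mulr_sumr.
  rewrite exchange_big; apply: eq_bigr => k _.
  by rewrite !mulr_sumr; apply: eq_bigr => j _; ring.
rewrite big1 ?mulr0// => k _.
by rewrite lim_metric_contract ?mulr0//; exact: limit_orthogonal.
Qed.

End Ray.

(** Reverse triangle inequality: [x_j >= - |x|] gives [|x + s e_j|^2 >= (|x| - s)^2]. *)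
Lemma enorm_near x (s : R) j : 0 <= s <= enorm x / 2 ->
  enorm x / 2 <= enorm (x + s *: delta_mx 0 j).
Proof.
move=> /andP[s0 sx]; have e0 := enorm_ge0 x.
rewrite -(@ler_pXn2r _ 2)// ?nnegrE ?enorm_ge0 ?divr_ge0//.
rewrite [leRHS]enorm_sqr dotpDZ -enorm_sqr.
have -> : dotp x (delta_mx 0 j) = x 0 j.
  rewrite -[RHS](sum_deltar j (fun i => x 0 i)); apply: eq_bigr => i _.
  by rewrite mxE eqxx /= mulrC eq_sym.
have -> : dotp (delta_mx 0 j) (delta_mx 0 j : E4) = 1.
  rewrite -[RHS](sum_deltar j (fun i => 1)); apply: eq_bigr => i _.
  by rewrite mxE eqxx /= eq_sym; case: (_ == _); rewrite ?mulr1 ?mulr0.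
have xj := coord_le_enorm x j.
have {}xj : - enorm x <= x 0 j by move: xj; rewrite ler_norml => /andP[].
have h1 : 0 <= s * (x 0 j + enorm x) by rewrite mulr_ge0// -lerBlDr sub0r.
have h2 : (enorm x / 2) ^+ 2 <= (enorm x - s) ^+ 2.
  by rewrite lerXn2r ?nnegrE ?divr_ge0//; lra.
move: h1 h2; move: (enorm x) (x 0 j) => e q; rewrite !expr2; nra.
Qed.

(* Rescaled by t, the remainder F(tx) - txA - c tends to 0 pointwise while its
   second derivatives stay bounded, so its first derivatives tend to 0 too. *)
Lemma lim_jac0 x j a : x != 0 -> lim_jac x j a = 0.
Proof.
move=> x0; have e0 := enorm_gt0 x0; pose m := enorm x / 2.
have m0 : 0 < m by rewrite divr_gt0.
have [C CP] := pd2_bound T.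
have C0 : 0 <= C.
  have [z [z0 /(_ j j a)]] := filter_ex (filterI (einfty_gt 0) CP).
  by move=> /(le_trans (normr_ge0 _)); rewrite pmulr_lge0// invr_gt0 exprn_gt0.
pose P z := (forall a, differentiable (fun z => F z 0 a) z) /\
  (forall i a, differentiable (pd i (fun z => F z 0 a)) z) /\
  (forall i j a, `|pd2 F i j a z| <= C / enorm z ^+ 3).
have [r rP] : \forall z \near einfty, P z :=
  filterI (iso_diff (tr_iso T)) (filterI (tr_diff2 T) CP).
(* Second-order expansion of the rescaled remainder over a step [e] in direction [j]: the values
   tend to 0, the linear term tends to [e * lim_jac x j a], and the quadratic term is at most
   [e ^+ 2 * (C / m ^+ 3)], as the step stays at distance [m] from the origin. Division by [e]
   leaves a bound that vanishes with [e]. *)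
have key e : 0 < e -> e <= m -> `|lim_jac x j a| <= e * (C / m ^+ 3).
  move=> e_gt0 em.
  have xe0 : x + e *: delta_mx 0 j != 0.
    have : 0 < enorm (x + e *: delta_mx 0 j).
      by rewrite (lt_le_trans m0)// enorm_near// em ltW.
    by apply: contraTneq => ->; rewrite enorm0 ltxx.
  have L : t * remainder (x + e *: delta_mx 0 j) a t - t * remainder x a t
      - e * (t ^+ 2 * (jac F (t *: x) j a - A j a)) @[t --> +oo] -->
      (0 - 0 - e * lim_jac x j a).
    refine (eq_cvgr _ (erefl _) (cvgB (cvgB (@remainder_expansion _ xe0 a)
      (@remainder_expansion _ x0 a)) (cvgM (cvg_cst e) (@jac_expansion _ x0 j a)))).
    exact: nearW.
  have {L} : `|0 - 0 - e * lim_jac x j a| <= e ^+ 2 * (C / m ^+ 3).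
    refine (cvgr_to_le (cvg_norm L) _).
    apply: filterS2 (nbhs_pinfty_gt (num_real (0 : R)))
      (nbhs_pinfty_gt (num_real (r / m))) => t t0 rt.
    have tm : r < t * m by rewrite -ltr_pdivrMr.
    have Pseg s : 0 <= s <= e -> t * m <= enorm (t *: x + (t * s) *: delta_mx 0 j) /\
        P (t *: x + (t * s) *: delta_mx 0 j).
      move=> /andP[s0 se]; suff tmle : t * m <= enorm (t *: x + (t * s) *: delta_mx 0 j).
        by split=> //; apply: rP; rewrite (lt_le_trans tm).
      rewrite -scalerA -scalerDr enormZ gtr0_norm// ler_pM2l// enorm_near// s0 /=.
      exact: le_trans em.
    have sumd (f : 'I_4 -> R) (q : R) :
        \sum_i (q *: delta_mx 0 j : E4) 0 i * f i = q * f j.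
      rewrite -[q * f j](sum_deltar j (fun i => q * f i)); apply: eq_bigr => i _.
      by rewrite !mxE eqxx /= [i == j]eq_sym; ring.
    have vE (s q : R) : t *: x + s *: (q *: delta_mx 0 j) = t *: x + (s * q) *: delta_mx 0 j.
      by rewrite scalerA.
    (* Two mean values in place of Taylor's formula: [s] for [F], then [s'] for its [j]-th
       derivative between 0 and [s * e]. *)
    have [s /andP[s0 s1]] : exists2 s, 0 <= s <= 1 &
        F (t *: (x + e *: delta_mx 0 j)) 0 a - F (t *: x) 0 a =
        t * e * jac F (t *: x + (t * (s * e)) *: delta_mx 0 j) j a.
      have [s /andP[s0 s1]|s s01] := @mvt_line _ (fun z => F z 0 a) (t *: x)
          ((t * e) *: delta_mx 0 j).
        rewrite vE mulrCA; have [] := Pseg (s * e); last by move=> _ [].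
        by rewrite mulr_ge0 ?(ltW e_gt0)//= ler_piMl// ltW.
      rewrite sumd.
      rewrite (vE s (t * e)).
      move=> E; exists s; first exact: s01.
      have -> : t *: (x + e *: delta_mx 0 j) = t *: x + (t * e) *: delta_mx 0 j.
        by rewrite scalerDr scalerA.
      have -> : t * (s * e) = s * (t * e) by rewrite mulrCA.
      by rewrite E mxE.
    have se0 : 0 <= s * e by rewrite mulr_ge0// ltW.
    have se : s * e <= e by rewrite ler_piMl// ltW.
    have [s' /andP[s'0 s'1] E2] : exists2 s', 0 <= s' <= 1 &
        jac F (t *: x + (t * (s * e)) *: delta_mx 0 j) j a - jac F (t *: x) j a =
        t * (s * e) * pd2 F j j a (t *: x + (t * (s' * (s * e))) *: delta_mx 0 j).
      have [s' /andP[s'0 s'1]|s' s'01] := @mvt_line _ (pd j (fun z => F z 0 a)) (t *: x)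
          ((t * (s * e)) *: delta_mx 0 j).
        rewrite vE mulrCA; have [] := Pseg (s' * (s * e)); last by move=> _ [_ []].
        by rewrite mulr_ge0//= (le_trans _ se)// ler_piMl.
      rewrite sumd.
      rewrite (vE s' (t * (s * e))).
      move=> E; exists s'; first exact: s'01.
      have -> : t * (s' * (s * e)) = s' * (t * (s * e)) by rewrite mulrCA.
      by rewrite !mxE E.
    move=> E1.
    have [tmq [_ [_ /(_ j j a) q3]]] := Pseg (s' * (s * e))
      (introT andP (conj (mulr_ge0 s'0 se0) (le_trans (ler_piMl se0 s'1) se))).
    move: E1 E2 tmq q3; set q := t *: x + (t * (s' * (s * e))) *: delta_mx 0 j.
    set Js := jac F (_ + _) j a; set J0 := jac F (t *: x) j a => E1 E2 tmq q3.
    (* The affine part of [F] cancels: [c] in the difference of the remainders, [A] against the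
       derivative at [t *: x]. *)
    have -> : t * remainder (x + e *: delta_mx 0 j) a t - t * remainder x a t
      - e * (t ^+ 2 * (J0 - A j a)) = t ^+ 3 * (e * (s * e)) * pd2 F j j a q.
      have Ae : ((x + e *: delta_mx 0 j) *m A) 0 a = (x *m A) 0 a + e * A j a.
        rewrite mulmxDl mxE; congr (_ + _); rewrite mxE -(sumd (fun i => A i a) e).
        by [].
      rewrite /remainder Ae.
      transitivity (t * ((F (t *: (x + e *: delta_mx 0 j)) 0 a - F (t *: x) 0 a)
         - t * e * J0)); first by ring.
      by rewrite E1 -mulrBr E2; ring.
    rewrite normrM ger0_norm; last by rewrite !mulr_ge0// ?exprn_ge0// ltW.
    have tm0 : 0 < t * m by rewrite mulr_gt0.
    have q3' : C / enorm q ^+ 3 <= C / (t * m) ^+ 3.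
      rewrite ler_wpM2l// lef_pV2 ?posrE ?exprn_gt0// ?(lt_le_trans tm0)//.
      by rewrite lerXn2r ?nnegrE ?(ltW tm0) ?enorm_ge0.
    apply: le_trans (ler_wpM2l _ (le_trans q3 q3')) _.
      by rewrite !mulr_ge0// ?exprn_ge0// ltW.
    rewrite [leLHS](_ : _ = e * (s * e) * (C / m ^+ 3)); last first.
      by field; rewrite !gt_eqF.
    rewrite expr2 ler_wpM2r ?divr_ge0 ?exprn_ge0// ?(ltW m0)//.
    by rewrite ler_wpM2l// ltW.
  rewrite subr0 sub0r normrN normrM gtr0_norm// expr2 -mulrA ler_pM2l//.
apply/eqP; rewrite -normr_le0; apply/ler_addgt0Pr => e e_gt0; rewrite add0r.
(* The [+ 1] keeps [D] positive even when [C = 0], so that [e / D] is a legitimate step. *)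
pose D := C / m ^+ 3 + 1.
have D0 : 0 < D by rewrite ltr_wpDl// divr_ge0// exprn_ge0// ltW.
pose d := Num.min m (e / D).
have d0 : 0 < d by rewrite lt_min m0 divr_gt0.
have dm : d <= m by rewrite ge_min lexx.
have de : d <= e / D by rewrite ge_min lexx orbT.
rewrite (le_trans (key d d0 dm))// (le_trans (y := d * D))//.
  by rewrite ler_wpM2l ?lerDl// ltW.
by rewrite -ler_pdivlMr.
Qed.

Lemma transition_rotation i j k l : W1 i j k l = rotate A W2 i j k l.
Proof.
apply: (weyl_rotate_unique (lam := lam) limit_orthogonal HW1 HW2) => {i j k l} x i j x0.
have S b : \sum_k A k b * lim_metric A lam W1 W2 x i k = 0.
  have := lim_jac0 i b x0; rewrite /lim_jac => /eqP.
  by rewrite mulf_eq0 invr_eq0 pnatr_eq0 /= => /eqP.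
apply/eqP; rewrite -subr_eq0 -/(lim_metric A lam W1 W2 x i j).
(* Multiplying [h A = 0] by [A^T] on the right gives [h = 0]. *)
have <- : \sum_b A j b * \sum_k A k b * lim_metric A lam W1 W2 x i k =
    lim_metric A lam W1 W2 x i j; last by rewrite big1// => b _; rewrite S mulr0.
under eq_bigr do rewrite mulr_sumr.
rewrite exchange_big -[RHS](sum_deltar j (fun k => lim_metric A lam W1 W2 x i k)).
apply: eq_bigr => k _.
have := congr1 (fun M : 'M[R]_4 => M j k) limit_orthogonal; rewrite mxE [in RHS]mxE => <-.
by rewrite mulr_suml; apply: eq_bigr => b _; rewrite mxE; ring.
Qed.

End Rigidity.


(** * The change of coordinates on the end *)

Section Decay.
Context {R : realType}.
Local Notation E4 := 'rV[R]_4.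
Local Notation tensor4 := ('I_4 -> 'I_4 -> 'I_4 -> 'I_4 -> R).

Lemma cvg_powRN (s : R) : 0 < s -> r `^ (- s) @[r --> +oo] --> (0 : R).
Proof.
move=> s0.
have L : r `^ s @[r --> +oo] --> +oo.
  apply/cvgryPge => A; near=> r.
  have r1 : (`|A| + 1) `^ s^-1 <= r by near: r; apply: nbhs_pinfty_ge; exact: num_real.
  have A1 : 0 <= `|A| + 1 by rewrite addr_ge0.
  have := ge0_ler_powR (ltW s0) _ _ r1; rewrite !nnegrE powR_ge0.
  rewrite (le_trans (powR_ge0 _ _) r1) -powRrM mulVf ?gt_eqF// powRr1// => /(_ isT isT).
  by apply: le_trans; rewrite (le_trans (ler_norm A))// lerDl.
under eq_fun do rewrite powRN.
apply/gtr0_cvgV0 => //; near=> r; apply: powR_gt0.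
by near: r; apply: nbhs_pinfty_gt; exact: num_real.
Unshelve. all: by end_near. Qed.

(** After multiplication by the power [n + size s] a spare factor [|x|^(- sigma)] remains, and it
    tends to 0. *)
Lemma bigO_infty_cvg0 (n : nat) (sigma : R) (f : E4 -> R) (s : seq 'I_4) : 0 < sigma ->
  bigO_infty (n%:R + sigma) f ->
  enorm x ^+ (n + size s) * pds s f x @[x --> einfty] --> 0.
Proof.
move=> s0 /(_ s) [C [rho fC]].
apply: (dominated_cvg0 (g := fun x => C * enorm x `^ (- sigma))).
  apply: filterS2 (einfty_gt 0) (einfty_gt rho) => x x0 /fC h.
  rewrite normrM ger0_norm ?exprn_ge0 ?enorm_ge0//.
  rewrite (le_trans (ler_wpM2l _ h)) ?exprn_ge0 ?enorm_ge0//.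
  rewrite mulrCA -powR_mulrn ?enorm_ge0// -powRD; last by rewrite (gt_eqF x0) implybT.
  by have -> : (n + size s)%:R + (- (n%:R + sigma) - (size s)%:R) = - sigma by rewrite natrD; ring.
refine (eq_cvgr _ (mulr0 C) (cvgM (cvg_cst C) (cvg_comp _ _ cvg_enorm (cvg_powRN s0)))).
exact: nearW.
Qed.

(** The empty multi-index gives [adm_exp], the multi-indices of length one give [adm_dexp]. *)
Lemma admissible_expansion lam sigma (W : tensor4) (G : E4 -> 'M[R]_4) : 0 < sigma ->
  (\forall x \near einfty, forall i j, differentiable (fun z => G z i j) x) ->
  (\forall x \near einfty, forall i j, G x i j = G x j i) ->
  metric_expansion lam sigma W G -> admissible lam W G.
Proof.
move=> s0 dG sG GE; split=> // [i j|i j k].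
  refine (eq_cvgr _ (erefl _) (bigO_infty_cvg0 [::] s0 (GE i j))).
  by apply: nearW => x; rewrite /= addn0 opprD addrA hquadE.
refine (eq_cvgr _ (erefl _) (bigO_infty_cvg0 [:: k] s0 (GE i j))).
apply: filterS2 dG einfty_neq0 => x dGx x0 /=; congr (_ * _).
transitivity (pd k (fun z => G z i j - ((i == j)%:R + hquad (mcoef lam W i j) z)) x).
  by congr (pd k _ x); apply/funext => z; rewrite hquadE.
have dh := is_derive_hquad (mcoef lam W i j) k x0.
have dg : is_derive x (delta_mx 0 k) (fun z => G z i j) (pd k (fun z => G z i j) x).
  by apply: derivableP; exact: diff_derivable.
apply: pd_val.
have := is_deriveB dg (is_deriveD (is_derive_cst ((i == j)%:R : R) x (delta_mx 0 k)) dh).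
by rewrite add0r.
Qed.

End Decay.

(** [differentiable] speaks about the chosen differential ['d g x], which must first be identified
    with ['d f x] by uniqueness. *)
Lemma near_eq_differentiable (K : numFieldType) (V W : normedModType K)
    (f g : V -> W) (x : V) : (\forall z \near x, f z = g z) ->
  differentiable f x -> differentiable g x.
Proof.
move=> fg df; have fx : f x = g x := nbhs_singleton fg.
have fg0 : \forall h \near (0 : V), f (h + x) = g (h + x).
  by move: fg; rewrite (near_shift 0) subr0.
have E : g \o shift x = cst (g x) + 'd f x +o_ 0 id.
  apply/eqaddoP => e e0; have /diff_locally /eqaddoP /(_ e e0) := df.
  by apply: filterS2 fg0 => h; rewrite /= !fctE /= fx => ->.
have dg : 'd g x = 'd f x :> (V -> W).
  by apply: diff_unique => //; exact: diff_continuous.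
by apply/diff_locallyP; rewrite dg; split => //; exact: diff_continuous.
Qed.

(** * Second-order differentiability of compositions *)

Section C2.
Context {R : realType}.
Local Notation E4 := 'rV[R]_4.
Implicit Types (x : E4) (f g : E4 -> R) (F K L : E4 -> E4).

(** A pointwise condition that supplies the assumptions of [pd_comm] and is stable under
    composition. *)
Definition C2 f x := (\forall z \near x, differentiable f z) /\
  forall i, differentiable (pd i f) x.

Definition vC2 F x := forall a, C2 (fun z => F z 0 a) x.

Lemma smooth_C2 (U : set E4) f x : nbhs x U -> smooth_on U f -> C2 f x.
Proof.
move=> Ux fU; split; first by apply: filterS Ux => z; exact: (fU [::]).
by move=> i; exact: (fU [:: i] _ (nbhs_singleton Ux)).
Qed.

Lemma C2_differentiable f x : C2 f x -> differentiable f x.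
Proof. by move=> [] /nbhs_singleton. Qed.

Lemma vC2_near F x : vC2 F x ->
  \forall z \near x, forall a, differentiable (fun z => F z 0 a) z.
Proof.
by move=> FC; apply: (@filter_forall _ _ _ (nbhs x) (nbhs_filter x)) => a; case: (FC a).
Qed.

Lemma vC2_continuous F x : vC2 F x -> {for x, continuous F}.
Proof.
move=> FC; apply: differentiable_continuous; apply: differentiable_vec => a.
exact: C2_differentiable.
Qed.

Lemma C2_comp f L x : C2 f (L x) -> vC2 L x -> C2 (f \o L) x.
Proof.
move=> [df d2f] LC; have Lc := vC2_continuous LC; have dL := vC2_near LC.
have dfL : \forall z \near x, differentiable f (L z) := Lc _ df.
split.
  apply: filterS2 dL dfL => z dLz dfz; apply: differentiable_comp => //.
  exact: differentiable_vec.
move=> i; apply: (near_eq_differentiable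
  (f := fun z => \sum_j pd i (fun z => L z 0 j) z * pd j f (L z))).
  by apply: filterS2 dL dfL => z dLz dfz; rewrite pd_comp.
apply: differentiable_sumf => j; apply: differentiable_mulf; first by have [_] := LC j.
apply: (@differentiable_comp _ _ _ _ L (pd j f)) => //.
by apply: differentiable_vec => a; exact: C2_differentiable.
Qed.

Lemma jac_comp K L x : (forall a, differentiable (fun z => K z 0 a) (L x)) ->
  (forall a, differentiable (fun z => L z 0 a) x) ->
  jac (K \o L) x = jac L x *m jac K (L x).
Proof.
move=> dK dL; apply/matrixP => i a; rewrite !mxE.
transitivity (pd i ((fun z => K z 0 a) \o L) x); first by [].
by rewrite pd_comp//; apply: eq_bigr => j _; rewrite !mxE.
Qed.

Lemma near_eq_jac K L x : (\forall z \near x, K z = L z) -> jac K x = jac L x.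
Proof.
move=> KL; apply/matrixP => i a; rewrite !mxE; apply: near_eq_derive.
by apply: filterS KL => z ->.
Qed.

End C2.


(** * Pullback of the metric in moving charts *)

Section Pullback.
Context {R : realType} {M : ptopologicalType} (g : riemannian4 R M).
Local Notation E4 := 'rV[R]_4.
Local Notation phi p := (cmap (chart_at g p)).
Local Notation psi p := (cinv (chart_at g p)).
Local Notation dm p := (dom (chart_at g p)).
Implicit Types (P : E4 -> M) (L : E4 -> E4) (z : E4).

(** Continuity is asked for near [z], because differentiating the pullback at [z] applies
    [pullback_chart] at all nearby points. *)
Definition C2_into P z := (\forall w \near z, {for w, continuous P}) /\
  forall p, dm p (P z) -> vC2 (phi p \o P) z.

Lemma near_dom P z p : {for z, continuous P} -> dm p (P z) ->
  \forall w \near z, dm p (P w).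
Proof.
move=> Pc dp; apply: (Pc (dm p)); apply: open_nbhs_nbhs; split => //.
exact: dom_open.
Qed.

Lemma smooth_into_C2 (U : set E4) P z : open U -> smooth_into g U P -> U z ->
  C2_into P z.
Proof.
move=> oU [Pc Ps] Uz; have nU : \forall w \near z, U w by exact: open_nbhs_nbhs.
split=> [|p dp a]; first by apply: filterS nU => w; exact: Pc.
by apply: (smooth_C2 _ (Ps p a)); apply: filterI nU _; exact: near_dom (Pc z Uz) dp.
Qed.

Lemma C2_into_comp P L z : C2_into P (L z) -> vC2 L z -> C2_into (P \o L) z.
Proof.
move=> [Pc Ps] LC; have Lc := vC2_continuous LC; split=> [|p dp a].
  have PLc : \forall w \near z, {for L w, continuous P} := Lc _ Pc.
  apply: filterS2 PLc (vC2_near LC) => w PLw dL; apply: continuous_comp => //.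
  by apply: differentiable_continuous; exact: differentiable_vec.
exact: (@C2_comp _ (fun u => (phi p \o P) u 0 a) L z (Ps p dp a) LC).
Qed.

(* [pullback] uses the chart indexed by the point P z itself, which changes with
   z; to differentiate, it has to be expressed in a fixed chart. *)
Lemma pullback_chart P z p : {for z, continuous P} -> dm p (P z) ->
  (forall a, differentiable (fun w => (phi p \o P) w 0 a) z) ->
  pullback g P z = pullback_mx (phi p \o P) (metric g p) z.
Proof.
move=> Pc dp dP; pose q := P z; pose tr := phi q \o psi p.
have pz : (phi p @` (dm p `&` dm q)) (phi p (P z)).
  by exists (P z) => //; split => //; exact: chart_at_dom.
(* Passing from the fixed chart [p] to the chart [q] of the point multiplies the Jacobian by that of
   the transition map, which [metric_compat] absorbs. *)
have J : jac (phi q \o P) z = jac (phi p \o P) z *m jac tr (phi p (P z)).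
  rewrite -jac_comp//; last first.
    by move=> a; exact: (@mfd_compat _ _ g p q a [::] _ pz).
  apply: near_eq_jac; apply: filterS (near_dom Pc dp) => w dw.
  by rewrite /tr /= cmapK.
rewrite /pullback -/q J /pullback_mx /= (metric_compat pz) /pullback_mx.
by rewrite /= cmapK// trmx_mul !mulmxA.
Qed.

Lemma pullback_differentiable P z i j : C2_into P z ->
  differentiable (fun w => pullback g P w i j) z.
Proof.
move=> [Pc Ps]; pose p := P z.
have dp : dm p (P z) by exact: chart_at_dom.
have vP := Ps p dp.
apply: (near_eq_differentiable (f := fun w => \sum_a \sum_b
    jac (phi p \o P) w i a * jac (phi p \o P) w j b * metric g p (phi p (P w)) a b)).
  apply: filterS3 Pc (near_dom (nbhs_singleton Pc) dp) (vC2_near vP) => w Pw dw dP.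
  by rewrite (pullback_chart Pw dw dP) pullback_mxE.
have dJ k a : differentiable (fun w => jac (phi p \o P) w k a) z.
  by under eq_fun do rewrite mxE; have [_] := vP a.
do 2 (apply: differentiable_sumf => ?).
apply: differentiable_mulf; first exact: differentiable_mulf.
apply: (@differentiable_comp _ _ _ _ (phi p \o P) (fun u => metric g p u _ _)).
  by apply: differentiable_vec => a; exact: C2_differentiable.
by apply: (@metric_smooth _ _ g p _ _ [::]); exists (P z).
Qed.

Lemma pullback_sym P z i j : pullback g P z i j = pullback g P z j i.
Proof.
suff S : (pullback g P z)^T = pullback g P z by rewrite -{1}S mxE.
rewrite /pullback !trmx_mul trmxK mulmxA Defs.metric_sym//.
by exists (P z) => //; exact: chart_at_dom.
Qed.

(** Both sides use the chart at [P (L z)], so only the chain rule enters and no transition map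
    appears. *)
Lemma pullback_comp P L z : C2_into P (L z) ->
  (forall a, differentiable (fun w => L w 0 a) z) ->
  pullback g (P \o L) z = pullback_mx L (pullback g P) z.
Proof.
move=> [_ Ps] dL; have dp : dm (P (L z)) (P (L z)) by exact: chart_at_dom.
rewrite /pullback_mx /pullback /=.
have -> : jac (phi (P (L z)) \o (P \o L)) z =
    jac L z *m jac (phi (P (L z)) \o P) (L z).
  by rewrite -jac_comp// => a; exact: (C2_differentiable (Ps _ dp a)).
by rewrite trmx_mul !mulmxA.
Qed.

Lemma near_eq_pullback P Q z : (\forall w \near z, P w = Q w) ->
  pullback g P z = pullback g Q z.
Proof.
move=> PQ; have PQz := nbhs_singleton PQ; rewrite /pullback PQz.
have -> // : jac (phi (Q z) \o P) z = jac (phi (Q z) \o Q) z.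
by apply: near_eq_jac; apply: filterS PQ => w /= ->.
Qed.

End Pullback.

(** * Coordinate changes on the cover of the end *)

Section EndCoordinates.
Context {R : realType} {M : ptopologicalType} (g : riemannian4 R M).
Context {tau : R} (E : ale_end g tau).
Local Notation E4 := 'rV[R]_4.
Implicit Types (c x y : end_coords (ale_radius E)).

Definition coord_change x y : E4 -> E4 := ec_map y \o ec_inv x.

Lemma ec_inv_C2 c z : exterior (ec_radius c) z -> vC2 (ec_inv c) z.
Proof.
move=> cz a; apply: (smooth_C2 _ (@ec_inv_smooth _ _ c a)).
by apply: open_nbhs_nbhs; split => //; exact: open_exterior.
Qed.

Lemma ec_map_C2 c z : ec_dom c z -> vC2 (ec_map c) z.
Proof.
move=> cz a; apply: (smooth_C2 _ (@ec_map_smooth _ _ c a)).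
by apply: open_nbhs_nbhs; split => //; exact: ec_dom_open.
Qed.

Lemma cover_coord_C2 c z : exterior (ec_radius c) z ->
  C2_into g (ale_cover E \o ec_inv c) z.
Proof.
move=> cz; apply: C2_into_comp; last exact: ec_inv_C2.
apply: smooth_into_C2 (ale_smooth E) _; first exact: open_exterior.
by apply: (@ec_dom_sub _ _ c); exact: ec_invP.
Qed.

Lemma ec_inv_large c (C : R) : \forall z \near einfty, C < enorm (ec_inv c z).
Proof.
have [rho rhoP] := ec_inv_infty c C.
by apply: filterS2 (einfty_gt (ec_radius c)) (einfty_gt rho) => z; exact: rhoP.
Qed.

Lemma ec_inv_dom x y : \forall z \near einfty,
  exterior (ec_radius x) z /\ ec_dom y (ec_inv x z).
Proof.
have [rho rhoP] := ec_dom_infty y.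
by apply: filterS2 (einfty_gt (ec_radius x)) (ec_inv_large x rho) => z xz /rhoP.
Qed.

Lemma coord_change_infty x y : coord_change x y z @[z --> einfty] --> einfty.
Proof.
move=> A [r rA]; have [rho rhoP] := ec_map_infty y r.
apply: filterS2 (ec_inv_dom x y) (ec_inv_large x rho) => z [_ yz] zr.
by apply: rA; exact: rhoP.
Qed.

Lemma coord_change_C2 x y z : exterior (ec_radius x) z -> ec_dom y (ec_inv x z) ->
  vC2 (coord_change x y) z.
Proof.
move=> xz yz a.
exact: (@C2_comp _ (fun u => ec_map y u 0 a) (ec_inv x) z (ec_map_C2 yz a) (ec_inv_C2 xz)).
Qed.

Lemma coord_changeK x y : \forall z \near einfty, coord_change y x (coord_change x y z) = z.
Proof.
by apply: filterS (ec_inv_dom x y) => z [xz yz]; rewrite /coord_change /= ec_mapK// ec_invK.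
Qed.

Lemma coord_change_isometric x y :
  isometric (coord_change x y) (coord_metric x) (coord_metric y).
Proof.
split; last exact: coord_change_infty.
  apply: filterS (ec_inv_dom x y) => z [xz yz] a.
  exact: (C2_differentiable (coord_change_C2 xz yz a)).
apply: filterS (near_einfty (ec_inv_dom x y)) => z nz.
have [xz yz] := nbhs_singleton nz.
(* Near [z], the inverse of [y] after the coordinate change is the inverse of [x], so both sides
   pull [g] back by the same map. *)
rewrite /coord_metric -pullback_comp.
- apply: near_eq_pullback; apply: filterS nz => w [xw yw].
  by rewrite /coord_change /= ec_mapK.
- by apply: cover_coord_C2; exact: ec_mapP.
- by move=> a; exact: (C2_differentiable (coord_change_C2 xz yz a)).
Qed.

Lemma coord_metric_admissible lam sigma W c : 0 < sigma ->
  metric_expansion lam sigma W (coord_metric c) -> admissible lam W (coord_metric c).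
Proof.
move=> s0; apply: admissible_expansion s0 _ _.
  apply: filterS (einfty_gt (ec_radius c)) => z cz i j.
  by apply: pullback_differentiable; exact: cover_coord_C2.
by apply: nearW => z i j; exact: pullback_sym.
Qed.

Lemma coord_change_transition lam sigma W1 W2 x y : 0 < sigma ->
  metric_expansion lam sigma W1 (coord_metric x) ->
  metric_expansion lam sigma W2 (coord_metric y) ->
  transition lam W1 W2 (coord_change x y) (coord_change y x)
    (coord_metric x) (coord_metric y).
Proof.
move=> s0 Gx Gy; split.
- exact: coord_metric_admissible Gx.
- exact: coord_metric_admissible Gy.
- exact: coord_change_isometric.
- exact: coord_change_isometric.
- exact: coord_changeK.
- exact: coord_changeK.
- apply: filterS (ec_inv_dom x y) => z [xz yz] i a.
  by have [_] := coord_change_C2 xz yz a.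
Qed.

End EndCoordinates.

Unset Implicit Arguments.

Theorem theorem1p7 (R : realType) (M : ptopologicalType) (g : riemannian4 R M)
    (hcomplete : rcomplete g)
    (hnoncompact : ~ compact [set: M])
    (mu : {measure set (g_sigma_algebraType (@open M)) -> \bar R})
    (hmu : riemannian_volume g mu)
    (hTV : TV_hypotheses g mu)
    (tau : R) (htau : 0 < tau) (E : ale_end g tau)
    (x y : end_coords (ale_radius E))
    (sigma : R) (hsigma : 0 < sigma < 1)
    (Wx Wy : 'I_4 -> 'I_4 -> 'I_4 -> 'I_4 -> R)
    (hWx : algebraic_weyl Wx) (hWy : algebraic_weyl Wy)
    (hgx : metric_expansion (9 * (group_order E)%:R * end_mass E) sigma Wx
             (coord_metric x))
    (hgy : metric_expansion (9 * (group_order E)%:R * end_mass E) sigma Wy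
             (coord_metric y))
    (hgaugex : relative_gauge ((group_order E)%:R * end_mass E)
                 (coord_metric x))
    (hgaugey : relative_gauge ((group_order E)%:R * end_mass E)
                 (coord_metric y)) :
  exists A : 'M[R]_4, A *m A^T = 1%:M /\
    forall i j k l : 'I_4,
      Wx i j k l =
      \sum_a \sum_b \sum_c \sum_d A a i * A b j * A c k * A d l * Wy a b c d.
Proof.
case/andP: hsigma => s0 _.
have T := coord_change_transition s0 hgx hgy.
have [A [c [K AK]]] := transition_limits T.
(* For row vectors the linear part is [x *m A] and [rotate] sums [A i a]; the statement sums
   [A a i], hence the transpose. *)
exists A^T; split.
  by rewrite trmxK; apply: mulmx1C; exact: (limit_orthogonal T AK).
move=> i j k l; rewrite (transition_rotation T hWx hWy AK).
apply: eq_bigr => a _; apply: eq_bigr => b _; apply: eq_bigr => m _.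
by apply: eq_bigr => d _; rewrite !mxE.
Qed.
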